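(* Let $0\le k\le n$ and $m\ge k$ be integers, let $\lambda=(\lambda_1,\dots,\lambda_k)$ be a partition satisfying $\lambda_1\le m-k$, and let $\mu=(m-k)^{n-k}\sqcup\lambda$. Let $\mathbf{x}=(x_1,\dots,x_n)$ and $\mathbf{t}=(t_1,\dots,t_n)$ be commuting indeterminates. Then $$G_\mu(\mathbf{x};\mathbf{t})=\sum_{S\in\binom{[n]}{k}}\ \prod_{i\in\overline{S}}x_i^m\ \prod_{i\in\overline{S}}\prod_{j\in S}\frac{1}{x_i-x_j}\ W_\lambda(\mathbf{x}_S;\mathbf{t}),$$ where $\mathbf{x}_S=\{x_{j_1},\dots,x_{j_k}\}$ for $S=\{j_1,\dots,j_k\}$ and $$W_\lambda(\mathbf{x}_S;\mathbf{t})=\sum_{\nu\subseteq(m-k)^k}E_{(m-k)^{n-k}\sqcup\lambda}^{(m-k)^{n-k}\sqcup\nu}(-\mathbf{t})\,s_\nu(\mathbf{x}_S).$$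
   Context: $\sqcup$ denotes concatenation of sequences and $a^b$ a sequence of $b$ copies of $a$, so $\mu=(m-k,\dots,m-k,\lambda_1,\dots,\lambda_k)$ has $n$ entries. $\binom{[n]}{k}$ is the set of $k$-element subsets of $\{1,\dots,n\}$ and $\overline{S}=\{1,\dots,n\}\setminus S$. The sum for $W_\lambda$ is over partitions $\nu=(\nu_1\ge\dots\ge\nu_k\ge0)$ with $\nu_1\le m-k$; $s_\nu$ is a Schur polynomial. **Coefficients.** For partitions $\eta\subseteq\kappa$ (English convention, row 1 at the top), $E_\eta^\kappa(\mathbf{t}):=\sum_{\mathcal{T}}\prod t_{i-\mathcal{T}_{ij}}$, where the sum is over all fillings $\mathcal{T}$ of the boxes $(i,j)$ (row $i$, column $j$) of $\kappa/\eta$ with positive integers that strictly increase along rows (left to right) and strictly increase down columns and satisfy $\mathcal{T}_{ij}<i$, and the product is over all boxes $(i,j)$ of $\kappa/\eta$. $E_\eta^\kappa:=0$ if $\eta\not\subseteq\kappa$, and $E_\eta^\kappa(-\mathbf{t})$ means each $t_r$ is replaced by $-t_r$. **Refined Grothendieck polynomial.** A (semistandard) set-valued tableau of shape $\mu$ is a filling of the boxes of $\mu$ with finite non-empty sets of positive integers such that if box $B$ is immediately to the right of box $A$ then $\max A\le\min B$, and if box $C$ is immediately below box $A$ then $\max A<\min C$. Let $\mathrm{SVT}^n(\mu)$ be the set of those with all entries at most $n$. For such $T$, let $e_i(T)$ be the number of extra entries in row $i$ (number of integers in row $i$ minus number of boxes in row $i$), and $\mathbf{x}^T=\prod_r x_r^{c_r}$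 where $c_r$ is the number of occurrences of $r$ in $T$. Then $G_\mu(\mathbf{x};\mathbf{t}):=\sum_{T\in\mathrm{SVT}^n(\mu)}\prod_i(-t_i)^{e_i(T)}\,\mathbf{x}^T$. *)

(* Defs.v *)
From mathcomp Require Import all_boot all_order all_algebra.
From mathcomp.multinomials Require Export mpoly.

Set Implicit Arguments.
Unset Strict Implicit.
Unset Printing Implicit Defensive.

Import GRing.Theory.

(* Partitions are nonincreasing sequences of naturals, possibly with zero
   parts. Rows, columns, tableau entries and variables are all numbered from 0:
   x_1, x_2, ... and t_1, t_2, ... are x`_0, x`_1, ... and t`_0, t`_1, ... *)

Definition included (eta kappa : seq nat) : bool :=
  all (fun i => nth 0 eta i <= nth 0 kappa i) (iota 0 (size eta)).

Definition box (kappa eta : seq nat) : finType :=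
  {c : 'I_(size kappa) * 'I_(\max_(r <- kappa) r)
     | nth 0 eta c.1 <= c.2 < nth 0 kappa c.1}.

Section Tableaux.
Variables kappa eta : seq nat.

Definition brow (b : box kappa eta) : nat := (val b).1.
Definition bcol (b : box kappa eta) : nat := (val b).2.

(* c is immediately to the right of (resp. immediately below) b *)
Definition right_of (b c : box kappa eta) : bool :=
  (brow c == brow b) && (bcol c == (bcol b).+1).
Definition below (b c : box kappa eta) : bool :=
  (brow c == (brow b).+1) && (bcol c == bcol b).

Definition tableau (A : Type) (rowrel colrel : rel A)
    (T : box kappa eta -> A) : bool :=
  [forall b, forall c, (right_of b c ==> rowrel (T b) (T c))
                    && (below b c ==> colrel (T b) (T c))].

End Tableaux.

(* For nonempty A and B: max A <= min B, resp. max A < min B. *)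
Definition set_le n (A B : {set 'I_n}) : bool :=
  [forall a in A, forall b in B, a <= b].
Definition set_lt n (A B : {set 'I_n}) : bool :=
  [forall a in A, forall b in B, a < b].

Definition is_svt n (mu : seq nat)
    (T : {ffun box mu [::] -> {set 'I_n}}) : bool :=
  [forall b, T b != set0] && tableau (@set_le n) (@set_lt n) T.

Definition is_ssyt n (nu : seq nat) (T : {ffun box nu [::] -> 'I_n}) : bool :=
  tableau (fun a b : 'I_n => a <= b) (fun a b : 'I_n => a < b) T.

(* The bound T b < brow b makes 'I_(size kappa) large enough for the entries. *)
Definition is_flagged_strict (kappa eta : seq nat)
    (T : {ffun box kappa eta -> 'I_(size kappa)}) : bool :=
  [forall b, T b < brow b]
  && tableau (fun a b : 'I_(size kappa) => a < b)
             (fun a b : 'I_(size kappa) => a < b) T.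

Definition excess n (mu : seq nat) (T : {ffun box mu [::] -> {set 'I_n}})
    (i : nat) : nat :=
  \sum_(b | brow b == i) #|T b| - #|[set b : box mu [::] | brow b == i]|.

Definition occurrences n (mu : seq nat) (T : {ffun box mu [::] -> {set 'I_n}})
    (r : 'I_n) : nat :=
  #|[set b | r \in T b]|.

Local Open Scope ring_scope.

Section Polynomials.
Variable R : comNzRingType.

(* The numbers of x-variables and y-variables are size x and size y; t is read
   as 0 beyond its size. *)
Definition groth (mu : seq nat) (x t : seq R) : R :=
  \sum_(T : {ffun box mu [::] -> {set 'I_(size x)}} | is_svt T)
    (\prod_(i < size mu) (- t`_i) ^+ excess T i)
    * \prod_(r < size x) x`_r ^+ occurrences T r.

Definition schur (nu : seq nat) (y : seq R) : R :=
  \sum_(T : {ffun box nu [::] -> 'I_(size y)} | is_ssyt T) \prod_b y`_(T b).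

(* t_{i - T_ij} has 0-based index i - T_ij - 1, a difference which is the same
   for 0-based and 1-based i and T_ij. *)
Definition Ecoef (eta kappa : seq nat) (t : seq R) : R :=
  if included eta kappa then
    \sum_(T : {ffun box kappa eta -> 'I_(size kappa)} | is_flagged_strict T)
      \prod_b t`_(brow b - T b).-1
  else 0.

Definition prepend (n m k : nat) (lam : seq nat) : seq nat :=
  nseq (n - k) (m - k)%N ++ lam.

Definition W (n m k : nat) (lam : seq nat) (y t : seq R) : R :=
  \sum_(nu : k.-tuple 'I_(m - k).+1 | sorted geq (map val nu))
    Ecoef (prepend n m k lam) (prepend n m k (map val nu)) (map -%R t)
    * schur (map val nu) y.

End Polynomials.

Section Indeterminates.
Variable n : nat.

(* The field of rational functions in x_1, ..., x_n, t_1, ..., t_n. *)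
Definition ratfun : fieldType := {fraction {mpoly int[n + n]}}.

Definition xvar (i : 'I_n) : ratfun :=
  tofrac ('X_(lshift n i) : {mpoly int[n + n]}).
Definition tvar (i : 'I_n) : ratfun :=
  tofrac ('X_(rshift n i) : {mpoly int[n + n]}).

Definition xvars : seq ratfun := [seq xvar i | i : 'I_n].
Definition tvars : seq ratfun := [seq tvar i | i : 'I_n].

Definition xvars_in (S : {set 'I_n}) : seq ratfun := [seq xvar i | i in S].

End Indeterminates.

(* Main.v *)
(** The refined Grothendieck polynomial and the Schur polynomials are both
    ratios of alternants.  Removing the largest letter from set-valued tableaux
    gives a branching rule which is also satisfied by
      det(x_j^(mu_i + n - i) prod_(s < i) (1 - t_s x_j)) / prod_(i < j) (x_i - x_j),
    by row operations that clear the column of the last variable; the case t = 0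
    is the bialternant formula for s_nu.  Expanding the factors 1 - t_s x_j of the
    numerator one s at a time, from the largest s down, adds vertical strips to
    mu, and the chains of vertical strips are the fillings counted by E.  Hence
    G_mu = sum_kappa E_mu^kappa(-t) s_kappa, where only the shapes
    kappa = (m-k)^(n-k), nu contribute.  Finally, the Laplace expansion of the
    alternant of such a kappa along its first n - k rows gives the sum over S. *)

Require Import Defs.
From mathcomp Require Import all_boot all_order all_algebra all_fingroup.
From mathcomp Require Import zify ring.

Set Implicit Arguments.
Unset Strict Implicit.
Unset Printing Implicit Defensive.

Import GRing.Theory.

Local Open Scope ring_scope.

(** * Tableaux as functions on a rectangle of cells *)

(** The type [box kappa eta] depends on the shape, while both peeling and branching change the
    shape. All fillings are therefore moved to functions on a fixed rectangle ['I_N * 'I_M], where a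
    default value marks the cells outside the shape, and shapes become functions on [nat]. Each
    recursion is then a bijection between functions on the same cells. The number [N] of rows is
    kept apart from the number [n] of letters, which alone decreases in the branching rule. Clearing
    the last column multiplies row i by 1 - t_i x_n, and dividing by the Vandermonde product needs
    distinct variables. The argument thus takes place in a field where these quantities are nonzero,
    as they are for the indeterminates in their fraction field. The Laplace expansion is applied to
    the quotient of a determinant by the Vandermonde product. Both change by the sign of a
    permutation of the variables, so the columns can be reordered for each S without tracking
    signs. *)

Lemma big_ffun_extend (R : Type) (idx : R) (op : Monoid.com_law idx)
    (X Y A : finType) (p : X -> Y) (d : Y -> A) (q : Y -> A -> A)
    (P : pred {ffun X -> A}) (f : {ffun X -> A} -> R) :
  injective p -> (forall y, involutive (q y)) ->
  \big[op/idx]_(T | P T) f T =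
  \big[op/idx]_(F : {ffun Y -> A} |
     [forall y, (y \in codom p) || (F y == d y)]
       && P [ffun x => q (p x) (F (p x))])
    f [ffun x => q (p x) (F (p x))].
Proof.
move=> injp qK.
(* The inverse map extends T by the default [d] off the image of [p]. The same twist [q y] is
   applied in both directions, hence the involution hypothesis; it is the identity for set-valued
   tableaux and a reversal of the entries for E. *)
rewrite (reindex_onto (fun F : {ffun Y -> A} => [ffun x => q (p x) (F (p x))])
  (fun T => [ffun y => if [pick x | p x == y] is Some x then q y (T x)
                       else d y])) /=; last first.
  move=> T _; apply/ffunP => x; rewrite !ffunE.
  case: pickP => [x' /eqP/injp -> | /(_ x)]; first by rewrite qK.
  by rewrite eqxx.
apply: eq_bigl => F; rewrite andbC; congr (_ && _).
apply/eqP/forallP => [/ffunP FE y | HF].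
  rewrite -(FE y) ffunE; case: pickP => [x /eqP <- | _].
    by rewrite codom_f.
  by rewrite eqxx orbT.
apply/ffunP => y; rewrite ffunE; case: pickP => [x /eqP <- | Hy].
  by rewrite !ffunE qK.
case/orP: (HF y) => [/codomP[x yE] | /eqP->] //.
by move: (Hy x); rewrite yE eqxx.
Qed.

Lemma prod_codom (R : comNzRingType) (X Y : finType) (p : X -> Y) (G : Y -> R) :
  injective p -> (forall y, y \notin codom p -> G y = 1) ->
  \prod_y G y = \prod_x G (p x).
Proof.
move=> injp G1; rewrite (bigID (fun y => y \in codom p)) /=.
rewrite [X in _ * X]big1 // mulr1 -big_uniq ?big_image //.
by rewrite map_inj_uniq // enum_uniq.
Qed.

Lemma prod_cells (R : comNzRingType) (I J : finType) (F : I * J -> R) :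
  \prod_b F b = \prod_i \prod_j F (i, j).
Proof. by rewrite pair_bigA; apply: eq_bigr => -[]. Qed.

Section Ambient.
Variable R : comNzRingType.
Variables N M : nat.
Implicit Types (mu : nat -> nat) (x t : nat -> R) (b c : 'I_N * 'I_M).

Definition adj_right b c := (c.1 == b.1 :> nat) && (c.2 == b.2.+1 :> nat).
Definition adj_below b c := (c.1 == b.1.+1 :> nat) && (c.2 == b.2 :> nat).

(** The empty set marks the cells outside [mu]. There [set_le] and [set_lt] hold vacuously, so the
    adjacency conditions need no restriction to the shape. *)
Definition svt_on n mu (T : {ffun 'I_N * 'I_M -> {set 'I_n}}) : bool :=
  [forall b, (T b != set0) == (b.2 < mu b.1)%N]
  && [forall b, forall c, (adj_right b c ==> set_le (T b) (T c))
                       && (adj_below b c ==> set_lt (T b) (T c))].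

(** The truncated subtraction gives weight 1 to the empty set, so products may run over the whole
    rectangle. *)
Definition box_weight n x t (i : nat) (A : {set 'I_n}) : R :=
  (- t i) ^+ (#|A| - 1) * \prod_(r in A) x r.

Definition groth_on n mu x t : R :=
  \sum_(T : {ffun 'I_N * 'I_M -> {set 'I_n}} | svt_on mu T)
    \prod_(b : 'I_N * 'I_M) box_weight x t b.1 (T b).

Lemma svt_onP n mu (T : {ffun 'I_N * 'I_M -> {set 'I_n}}) :
  reflect [/\ forall b, (T b != set0) = (b.2 < mu b.1)%N,
      forall b c, adj_right b c ->
        forall r s, r \in T b -> s \in T c -> (r <= s)%N
    & forall b c, adj_below b c ->
        forall r s, r \in T b -> s \in T c -> (r < s)%N]
   (svt_on mu T).
Proof.
apply: (iffP andP) => [[/forallP H1 /forallP H2] | [H1 H2 H3]].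
  split => [b | b c bc r s rb sc | b c bc r s rb sc]; first exact: eqP (H1 b).
    have /forallP/(_ c)/andP[/implyP/(_ bc) + _] := H2 b.
    by move/forall_inP/(_ r rb)/forall_inP/(_ s sc).
  have /forallP/(_ c)/andP[_ /implyP/(_ bc) +] := H2 b.
  by move/forall_inP/(_ r rb)/forall_inP/(_ s sc).
split; apply/forallP => b; first by rewrite H1.
apply/forallP => c; apply/andP; split; apply/implyP => bc;
  apply/forall_inP => r rb; apply/forall_inP => s sc.
- exact: H2 bc _ _ rb sc.
- exact: H3 bc _ _ rb sc.
Qed.

End Ambient.

Section BoxWeights.
Variable R : comNzRingType.
Variables (mu : seq nat) (n : nat) (T : {ffun box mu [::] -> {set 'I_n}}).

Lemma svt_weight (x t : nat -> R) : is_svt T ->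
  (\prod_(i < size mu) (- t i) ^+ excess T i) * \prod_(r < n) x r ^+ occurrences T r
  = \prod_b box_weight x t (brow b) (T b).
Proof.
case/andP=> /forallP Tn0 _; rewrite /box_weight big_split /=; congr (_ * _).
  rewrite (partition_big (fun b : box mu [::] => (val b).1) xpredT) //=.
  apply: eq_bigr => i _.
  rewrite (eq_bigr (fun b => (- t i) ^+ (#|T b| - 1))); last first.
    by move=> b /eqP <-.
  rewrite prodrXr; congr (_ ^+ _).
  (* The truncated differences can be summed row by row because no box is empty. *)
  rewrite /excess sumnB; last by move=> b _; rewrite card_gt0.
  by rewrite sum1_card; congr (_ - _)%N; apply: eq_card => b; rewrite inE.
under [RHS]eq_bigr => b _ do rewrite big_mkcond /=.
rewrite exchange_big /=; apply: eq_bigr => r _.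
rewrite -big_mkcond /= prodr_const; congr (_ ^+ _).
by apply: eq_card => b; rewrite inE.
Qed.

End BoxWeights.

Section BoxEmbedding.
Variables (kappa eta : seq nat) (M : nat).
Hypothesis kappaM : (\max_(r <- kappa) r <= M)%N.

Definition cell_of_box (b : box kappa eta) : 'I_(size kappa) * 'I_M :=
  ((val b).1, widen_ord kappaM (val b).2).

Lemma cell_of_box_inj : injective cell_of_box.
Proof.
case=> [[b1 b2] pb] [[c1 c2] pc] [] /= bc1 bc2; apply/val_inj => /=.
by rewrite bc1; congr (_, _); apply/val_inj.
Qed.

Lemma codom_cell_of_box (c : 'I_(size kappa) * 'I_M) :
  (c \in codom cell_of_box) = (nth 0%N eta c.1 <= c.2 < nth 0%N kappa c.1)%N.
Proof.
apply/codomP/idP => [[b ->] /=|]; first exact: (valP b).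
case: c => i j /= H.
have jlt : (j < \max_(r <- kappa) r)%N.
  case/andP: H => _ /leq_trans; apply.
  by apply: (@leq_bigmax_seq _ _ xpredT id) => //; apply: mem_nth.
pose c0 : 'I_(size kappa) * 'I_(\max_(r <- kappa) r) := (i, Ordinal jlt).
exists (exist _ c0 H : box kappa eta).
by congr (_, _); apply/val_inj.
Qed.

End BoxEmbedding.

Lemma groth_ambient (R : comNzRingType) (N M n : nat) (mu : seq nat) (x t : seq R) :
  size mu = N -> size x = n -> (\max_(r <- mu) r <= M)%N ->
  groth mu x t = groth_on N M n (nth 0%N mu) (nth 0 x) (nth 0 t).
Proof.
move=> <- <- muM; rewrite /groth.
under eq_bigr => T svtT do rewrite (svt_weight (nth 0 x) (nth 0 t) svtT).
rewrite (@big_ffun_extend _ _ _ _ _ _ _ (fun=> set0) (fun=> id)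
  _ _ (@cell_of_box_inj mu [::] M muM)) //=.
apply: eq_big => [F | F /andP[/forallP HF _]].
  apply/andP/svt_onP => [[/forallP HF /andP[/forallP H1 /forallP H2]] | [H1 H2 H3]].
    have Fn0 b : (F b != set0) = (b.2 < nth 0%N mu b.1)%N.
      have := codom_cell_of_box [::] muM b; rewrite nth_nil leq0n /= => <-.
      apply/idP/idP => [Fb|/codomP[c ->]]; last by have := H1 c; rewrite ffunE.
      by have := HF b; rewrite (negPf Fb) orbF.
    have inC b r : r \in F b -> {c : box mu [::] | b = cell_of_box muM c}.
      move=> rb; have : b \in codom (cell_of_box (eta := [::]) muM).
        rewrite codom_cell_of_box nth_nil leq0n /= -Fn0; apply/set0Pn; by exists r.
      move=> Hb; exists (iinv Hb); by rewrite f_iinv.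
    split=> // b c bc r s rb sc;
      case: (inC _ _ rb) (inC _ _ sc) => b' bE [c' cE]; subst b c;
      have /forallP/(_ c')/andP[/implyP R1 /implyP R2] := H2 b';
      [move: (R1 bc) | move: (R2 bc)]; rewrite !ffunE;
      by move/forall_inP/(_ r rb)/forall_inP/(_ s sc).
  split.
    apply/forallP => b; rewrite codom_cell_of_box nth_nil leq0n /= -H1.
    by case: eqVneq.
  apply/andP; split; apply/forallP => b.
    by rewrite ffunE H1 /=; have /andP[] := valP b.
  apply/forallP => c; apply/andP; split; apply/implyP => bc; rewrite !ffunE;
  apply/forall_inP => r rb; apply/forall_inP => s sc.
  - exact: (H2 (cell_of_box muM b) (cell_of_box muM c) bc).
  - exact: (H3 (cell_of_box muM b) (cell_of_box muM c) bc).
rewrite (prod_codom (@cell_of_box_inj mu [::] M muM)); last first.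
  move=> b Hb; have := HF b; rewrite (negPf Hb) /= => /eqP ->.
  by rewrite /box_weight cards0 sub0n expr0 big_set0 mulr1.
by apply: eq_bigr => b _; rewrite ffunE.
Qed.

(** With [t] empty every [t_i] is read as 0, so a tableau with an extra entry has weight 0, while
    [0 ^+ 0 = 1] keeps the tableaux whose boxes are singletons. *)
Lemma schur_groth (R : comNzRingType) (nu : seq nat) (y : seq R) :
  schur nu y = groth nu y [::].
Proof.
rewrite /groth.
under eq_bigr => T svtT do rewrite (svt_weight (nth 0 y) (nth 0 [::]) svtT).
rewrite (bigID (fun T : {ffun box nu [::] -> {set 'I_(size y)}} =>
  [forall b, #|T b| == 1%N])) /=.
rewrite [X in _ + X]big1 ?addr0; last first.
  move=> T /andP[/andP[/forallP T0 _] /forallPn[b Tb]].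
  rewrite (bigD1 b) //= {1}/box_weight nth_nil oppr0 expr0n.
  have -> : (#|T b| - 1 == 0)%N = false.
    apply/negbTE; rewrite subn_eq0 -ltnNge ltn_neqAle eq_sym Tb /= card_gt0.
    exact: T0.
  by rewrite mul0r mul0r.
pose single (S : {ffun box nu [::] -> 'I_(size y)}) := [ffun b => [set S b]].
have single_inj : injective single.
  move=> S S' /ffunP SS'; apply/ffunP => b.
  by have := SS' b; rewrite !ffunE => /set1_inj.
have tab_single S : tableau (@set_le (size y)) (@set_lt (size y)) (single S) = is_ssyt S.
  apply: eq_forallb => b; apply: eq_forallb => c; rewrite !ffunE.
  congr ((_ ==> _) && (_ ==> _)); apply/forall_inP/idP => [/(_ _ (set11 _)) | H].
  - by move/forall_inP/(_ _ (set11 _)).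
  - by move=> i /set1P ->; apply/forall_inP => j /set1P ->.
  - by move/forall_inP/(_ _ (set11 _)).
  - by move=> i /set1P ->; apply/forall_inP => j /set1P ->.
rewrite (eq_bigl (fun T => T \in single @: [set S | is_ssyt S])); last first.
  move=> T; apply/andP/imsetP => [[/andP[_ svtT] /forallP T1] | [S]].
    have /fin_all_exists[S SE] : forall b, exists i, T b = [set i].
      by move=> b; apply/cards1P/T1.
    have TE : T = single (finfun S).
      by apply/ffunP => b; rewrite !ffunE SE.
    by exists (finfun S); rewrite // inE -tab_single -TE.
  rewrite inE => ssytS ->; split; last first.
    by apply/forallP => b; rewrite ffunE cards1.
  rewrite /is_svt tab_single ssytS andbT; apply/forallP => b.
  by rewrite ffunE; apply/set0Pn; exists (S b); rewrite set11.
rewrite big_imset /=; last by move=> S S' _ _; apply: single_inj.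
apply: eq_big => [S | S _]; first by rewrite inE.
apply: eq_bigr => b _.
by rewrite ffunE /box_weight cards1 expr0 mul1r big_set1.
Qed.

(** * Flagged fillings on the rectangle *)

Section Strips.
Variable R : comNzRingType.
Variables N M : nat.
Implicit Types (eta kappa : nat -> nat) (t : nat -> R) (b c : 'I_N * 'I_M).

(* [g b] is one more than the 0-based index of the variable t attached to the
   box [b], and 0 outside of kappa/eta. *)
Definition flagged_on r eta kappa (g : {ffun 'I_N * 'I_M -> 'I_N}) : bool :=
  [forall b, [&& (0 < g b) == (eta b.1 <= b.2 < kappa b.1), g b <= b.1 & g b <= r]%N]
  && [forall b, forall c, (0 < g b)%N && (0 < g c)%N ==>
        (adj_right b c ==> (g c < g b)%N) && (adj_below b c ==> (g c <= g b)%N)].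

(** The parameter [r] allows only the first [r] variables t, and the induction removes them from the
    last one down. For [r = N] it is no constraint, as the entries lie in ['I_N]. *)
Definition E_on r eta kappa t : R :=
  if [forall i : 'I_N, eta i <= kappa i]%N then
    \sum_(g : {ffun 'I_N * 'I_M -> 'I_N} | flagged_on r eta kappa g)
      \prod_b (if (0 < g b)%N then t (g b).-1 else 1)
  else 0.

Lemma flagged_onP r eta kappa (g : {ffun 'I_N * 'I_M -> 'I_N}) :
  reflect [/\ forall b, (0 < g b)%N = (eta b.1 <= b.2 < kappa b.1)%N,
      forall b, (g b <= b.1)%N, forall b, (g b <= r)%N,
      forall b c, (0 < g b)%N -> (0 < g c)%N -> adj_right b c -> (g c < g b)%N
    & forall b c, (0 < g b)%N -> (0 < g c)%N -> adj_below b c -> (g c <= g b)%N]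
   (flagged_on r eta kappa g).
Proof.
apply: (iffP andP) => [[/forallP H1 /forallP H2] | [H1 H2 H3 H4 H5]].
  split => [b | b | b | b c b0 c0 bc | b c b0 c0 bc].
  - by case/and3P: (H1 b) => /eqP.
  - by case/and3P: (H1 b).
  - by case/and3P: (H1 b).
  - by have /forallP/(_ c) := H2 b; rewrite b0 c0 bc => /andP[].
  - by have /forallP/(_ c) := H2 b; rewrite b0 c0 bc => /andP[].
split; apply/forallP => b; first by rewrite H1 eqxx H2 H3.
apply/forallP => c; apply/implyP => /andP[b0 c0].
by apply/andP; split; apply/implyP => bc; [apply: H4 | apply: H5].
Qed.

End Strips.

(** The substitution g = i - T turns the flag condition T < i into 0 < g <= i, which frees 0 as the
    mark of the outside. Strict increase of T along rows becomes strict decrease of g; strict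
    increase down columns becomes weak decrease, because i grows by one as well. *)
Lemma Ecoef_ambient (R : comNzRingType) (N M : nat) (eta kappa : seq nat) (t : seq R) :
  size kappa = N -> size eta = N -> (\max_(r <- kappa) r <= M)%N ->
  Ecoef eta kappa t = E_on N M N (nth 0%N eta) (nth 0%N kappa) (nth 0 t).
Proof.
move=> <- sz kM; rewrite /Ecoef /E_on.
have -> : included eta kappa =
    [forall i : 'I_(size kappa), nth 0%N eta i <= nth 0%N kappa i]%N.
  apply/allP/forallP => [H i | H i]; first by apply: H; rewrite mem_iota sz ltn_ord.
  by rewrite mem_iota sz => /andP[_ ilt]; apply: (H (Ordinal ilt)).
case: ifP => // _.
(* Values above the row index are left fixed so that [flip b] is an involution of all of
   ['I_(size kappa)]. *)
pose flip (b : 'I_(size kappa) * 'I_M) (a : 'I_(size kappa)) : 'I_(size kappa) :=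
  if (a <= b.1)%N then Ordinal (leq_ltn_trans (leq_subr a b.1) (ltn_ord b.1)) else a.
have flipE (b : 'I_(size kappa) * 'I_M) (a : 'I_(size kappa)) :
    (a <= b.1)%N -> flip b a = (b.1 - a)%N :> nat.
  by rewrite /flip => ->.
have flip_lt (b : 'I_(size kappa) * 'I_M) (a : 'I_(size kappa)) :
    (flip b a < b.1)%N = (0 < a <= b.1)%N.
  by rewrite /flip; case: (leqP a b.1) => /= ab; lia.
have flipK b : involutive (flip b).
  move=> a; apply/val_inj => /=; case: (leqP a b.1) => ab.
    by rewrite flipE flipE ?leq_subr // subKn.
  have fa : flip b a = a by rewrite /flip leqNgt ab.
  by rewrite !fa.
have z0 (b : 'I_(size kappa) * 'I_M) : (0 < size kappa)%N.
  by case: b => [[i /(leq_ltn_trans (leq0n _))]].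
rewrite (@big_ffun_extend _ _ _ _ _ _ _ (fun b => Ordinal (z0 b)) flip
  _ _ (@cell_of_box_inj kappa eta M kM)) //=.
apply: eq_big => [F | F /andP[/forallP HF /andP[/forallP Hlt _]]].
  apply/andP/flagged_onP => [[/forallP HF /andP[/forallP H1 /forallP H2]] | [H1 H2 H3 H4 H5]].
    have {HF} F0 b : (0 < F b)%N -> {c : box kappa eta | b = cell_of_box kM c}.
      move=> Fb; have Hb : b \in codom (@cell_of_box kappa eta M kM).
        by have := HF b; case/orP => // /eqP FE; rewrite FE in Fb.
      by exists (iinv Hb); rewrite f_iinv.
    have {H1} Fin (b : box kappa eta) : (0 < F (cell_of_box kM b) <= brow b)%N.
      by have := H1 b; rewrite ffunE (flip_lt (cell_of_box kM b)).
    have Fle b : (F b <= b.1)%N.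
      case: (posnP (F b)) => [-> // | /F0[c ->]].
      by case/andP: (Fin c).
    split=> // [b | b | b c /F0[b' bE] /F0[c' cE] bc | b c /F0[b' bE] /F0[c' cE] bc].
    - rewrite -(codom_cell_of_box eta kM).
      apply/idP/codomP => [/F0[c ->] | [c ->]]; first by exists c.
      by case/andP: (Fin c).
    - exact: leq_trans (Fle b) (ltnW (ltn_ord _)).
    - have /forallP/(_ c')/andP[/implyP H _] := H2 b'; subst b c.
      have := H bc; rewrite !ffunE !flipE ?Fle //.
      have := Fin b'; have := Fin c'; case/andP: bc => /eqP /= cb _.
      by rewrite /brow cb; lia.
    - have /forallP/(_ c')/andP[_ /implyP H] := H2 b'; subst b c.
      have := H bc; rewrite !ffunE !flipE ?Fle //.
      have := Fin b'; have := Fin c'; case/andP: bc => /eqP /= cb _.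
      by rewrite /brow cb; lia.
  have Fpos (b : box kappa eta) : (0 < F (cell_of_box kM b))%N.
    by rewrite H1; apply: (valP b).
  split.
    apply/forallP => b; rewrite codom_cell_of_box -H1.
    by case: (posnP (F b)) => //= F0; rewrite -val_eqE /= F0.
  apply/andP; split; apply/forallP => b.
    rewrite ffunE flipE ?H2 // /brow /=; have := H2 (cell_of_box kM b).
    by have := Fpos b => /=; lia.
  apply/forallP => c; rewrite !ffunE !flipE ?H2 //.
  have := H2 (cell_of_box kM b); have := H2 (cell_of_box kM c).
  have := Fpos b; have := Fpos c => /= c0 b0 leb lec.
  apply/andP; split; apply/implyP => bc.
    have := H4 (cell_of_box kM b) (cell_of_box kM c) b0 c0 bc.
    case/andP: bc => /eqP cb _.
    have {cb} : (sval c).1 = (sval b).1 :> nat := cb.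
    by move: c0 b0 leb lec => /=; lia.
  have := H5 (cell_of_box kM b) (cell_of_box kM c) b0 c0 bc.
  case/andP: bc => /eqP cb _.
  have {cb} : (sval c).1 = (sval b).1.+1 :> nat := cb.
  by move: c0 b0 leb lec => /=; lia.
rewrite [RHS](prod_codom (@cell_of_box_inj kappa eta M kM)); last first.
  by move=> b Hb; have := HF b; rewrite (negPf Hb) /= => /eqP ->.
apply: eq_bigr => b _; have := Hlt b; rewrite !ffunE (flip_lt (cell_of_box kM b)).
by case/andP => -> le; rewrite flipE ?subKn.
Qed.

(** * Peeling a vertical strip off a flagged filling *)

Definition dec_on N (mu : nat -> nat) : bool :=
  [forall i : 'I_N, forall j : 'I_N, (j == i.+1 :> nat) ==> (mu j <= mu i)%N].

Lemma dec_onP N (mu : nat -> nat) :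
  reflect (forall i, (i.+1 < N)%N -> (mu i.+1 <= mu i)%N) (dec_on N mu).
Proof.
apply: (iffP forallP) => [H i iN | H i].
  by have /forallP/(_ (Ordinal iN))/implyP := H (Ordinal (ltnW iN)); apply.
by apply/forallP => j; apply/implyP => /eqP ji; rewrite ji H // -ji.
Qed.

Lemma dec_onS N (mu : nat -> nat) i :
  dec_on N mu -> (i.+1 < N)%N -> (mu i.+1 <= mu i)%N.
Proof. by move/dec_onP; apply. Qed.

Definition add_strip N (mu : nat -> nat) (c : {ffun 'I_N -> bool}) (i : nat) : nat :=
  (mu i + oapp c false (insub i))%N.

Lemma add_stripE N (mu : nat -> nat) (c : {ffun 'I_N -> bool}) (i : 'I_N) :
  add_strip mu c i = (mu i + c i)%N.
Proof. by rewrite /add_strip valK. Qed.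

(** The strip belonging to [t r] avoids rows 0 to [r]. In a filling, the value [r.+1] is at most the
    row index; in the alternant, the factor 1 - t_r x_j is present only in rows i > r. *)
Definition strip_on N r (mu : nat -> nat) (c : {ffun 'I_N -> bool}) : bool :=
  [forall i, c i ==> (r < i)%N] && dec_on N (add_strip mu c).

Section Peel.
Variables (N M r : nat) (eta kappa : nat -> nat).
Hypothesis kappa_dec : dec_on N kappa.
Hypothesis eta_dec : dec_on N eta.
Hypothesis kappaM : forall i, (i < N)%N -> (kappa i <= M)%N.

Let attach (cg : {ffun 'I_N -> bool} * {ffun 'I_N * 'I_M -> 'I_N}) :
    {ffun 'I_N * 'I_M -> 'I_N} :=
  [ffun b : 'I_N * 'I_M => if cg.1 b.1 && (b.2 == eta b.1 :> nat) then insubd b.1 r.+1 else cg.2 b].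

Let detach (g : {ffun 'I_N * 'I_M -> 'I_N}) :=
  ([ffun i : 'I_N => [exists j : 'I_M, (j == eta i :> nat) && (g (i, j) == r.+1 :> nat)]],
   [ffun b : 'I_N * 'I_M => if g b == r.+1 :> nat then insubd b.1 0%N else g b]).

Let val0 (i : 'I_N) : insubd i 0%N = 0%N :> nat.
Proof. by rewrite val_insubd (leq_ltn_trans (leq0n _) (ltn_ord i)). Qed.

(** Rows of [g] decrease strictly, so the largest allowed value [r.+1] can only occupy the first box
    of kappa/eta in its row. The rows where it occurs form the strip, and erasing it leaves a
    filling bounded by [r]. *)
Lemma detach_valid g :
  [forall i : 'I_N, eta i <= kappa i]%N -> flagged_on r.+1 eta kappa g ->
  [/\ strip_on r eta (detach g).1,
      [forall i : 'I_N, add_strip eta (detach g).1 i <= kappa i]%N,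
      flagged_on r (add_strip eta (detach g).1) kappa (detach g).2
    & attach (detach g) = g].
Proof.
move=> /forallP inc /flagged_onP[G0 G1 G2 G3 G4].
have top b : g b = r.+1 :> nat -> b.2 = eta b.1 :> nat.
  move=> gb; have : (0 < g b)%N by rewrite gb.
  rewrite G0 => /andP[]; rewrite leq_eqVlt => /orP[/eqP -> //| lt1 lt2].
  have ltM : (b.2.-1 < M)%N by apply: leq_ltn_trans (leq_pred _) (ltn_ord _).
  pose b' : 'I_N * 'I_M := (b.1, Ordinal ltM).
  have b'0 : (0 < g b')%N by rewrite G0 /=; lia.
  have := G3 b' b b'0; rewrite gb => /(_ isT).
  have -> : adj_right b' b by rewrite /adj_right /=; lia.
  by move/(_ isT); have := G2 b'; lia.
have cE (b : 'I_N * 'I_M) : (detach g).1 b.1 && (b.2 == eta b.1 :> nat) = (g b == r.+1 :> nat).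
  rewrite ffunE; apply/andP/eqP => [[/existsP[j /andP[/eqP jE /eqP gE]] /eqP bE] | gb].
    by rewrite -gE; congr (nat_of_ord (g _)); case: (b) jE bE => /= i j' je be;
       congr (_, _); apply/val_inj => /=; rewrite je.
  split; last by rewrite (top _ gb).
  by apply/existsP; exists b.2; rewrite (top _ gb) eqxx /= -surjective_pairing gb.
have gE b : (detach g).2 b = (if g b == r.+1 :> nat then 0%N else g b) :> nat.
  by rewrite ffunE; case: ifP => // _; rewrite val0.
have c_top i : (detach g).1 i -> exists2 j : 'I_M, j = eta i :> nat & g (i, j) = r.+1 :> nat.
  by rewrite ffunE => /existsP[j /andP[/eqP jE /eqP]]; exists j.
have cK i : (detach g).1 i -> (eta i < kappa i)%N.
  case/c_top => j jE gj; have : (0 < g (i, j))%N by rewrite gj.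
  by rewrite G0 /= jE; case/andP.
split.
- apply/andP; split.
    apply/forallP => i; apply/implyP => /c_top[j _ gj].
    by have := G1 (i, j); rewrite gj.
  apply/forallP => i; apply/forallP => j; apply/implyP => /eqP ji.
  rewrite !add_stripE; have dij := dec_onS (i := i) eta_dec; rewrite -ji in dij.
  have {}dij := dij (ltn_ord j).
  case cj : ((detach g).1 j); last by rewrite addn0; apply: leq_trans dij (leq_addr _ _).
  move: dij; rewrite leq_eqVlt => /orP[/eqP eij | lt]; last by rewrite addn1; lia.
  (* Rows i and j of eta have equal length and row j is selected. The box of row i above the
     selected one carries at least [r.+1], hence exactly that, so row i is selected too. *)
  have [l lE gl] := c_top _ cj.
  have il0 : (0 < g (i, l))%N.
    have kij : (kappa j <= kappa i)%N by rewrite ji; apply: (dec_onS kappa_dec); rewrite -ji.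
    by have := cK _ cj; rewrite G0 /= lE; lia.
  have := G4 (i, l) (j, l) il0; rewrite gl => /(_ isT).
  rewrite /adj_below /= ji !eqxx => /(_ isT) gil.
  have := cE (i, l); rewrite /= lE eij eqxx andbT => ->.
  by rewrite -ji eij; case: eqP => [_|[]]; [rewrite leqnn | apply/eqP; rewrite eqn_leq G2].
- apply/forallP => i; rewrite add_stripE.
  by case ci : ((detach g).1 i); [rewrite addn1 cK | rewrite addn0 inc].
- apply/flagged_onP; split => [b | b | b | b b' | b b']; rewrite !gE.
  + rewrite add_stripE -cE; case: ((detach g).1 b.1) => /=; last by rewrite addn0 G0.
    rewrite addn1; case: eqP => [-> | bE]; first by rewrite !ltnn.
    by rewrite G0; lia.
  + by case: ifP.
  + by case: eqP => // gb; have := G2 b; lia.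
  + by case: eqP => // _ b0; case: eqP => // _ b'0; apply: G3.
  + by case: eqP => // _ b0; case: eqP => // _ b'0; apply: G4.
- apply/ffunP => b; rewrite [LHS]ffunE cE; case: ifP => [/eqP gb | gb].
    by apply/val_inj; rewrite val_insubd -gb ltn_ord.
  by apply/val_inj; rewrite /= gE gb.
Qed.

Lemma attach_valid c g :
  strip_on r eta c ->
  [forall i : 'I_N, add_strip eta c i <= kappa i]%N ->
  flagged_on r (add_strip eta c) kappa g ->
  [/\ [forall i : 'I_N, eta i <= kappa i]%N,
      flagged_on r.+1 eta kappa (attach (c, g)),
      detach (attach (c, g)) = (c, g)
    & forall b, attach (c, g) b =
         (if c b.1 && (b.2 == eta b.1 :> nat) then r.+1 else g b) :> nat].
Proof.
case/andP => /forallP cr /dec_onP cdec /forallP inc /flagged_onP[G0 G1 G2 G3 G4].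
have {}cr i : c i -> (r < i)%N by apply/implyP.
(* The default of [insubd] is never reached: a selected row i satisfies r < i < N, so [r.+1] is a
   valid index. *)
have aE b : attach (c, g) b = (if c b.1 && (b.2 == eta b.1 :> nat) then r.+1 else g b) :> nat.
  rewrite ffunE /=; case: ifP => // /andP[/cr cb _].
  by rewrite val_insubd (leq_ltn_trans cb).
have {}G0 (b : 'I_N * 'I_M) : (0 < g b)%N = (eta b.1 + c b.1 <= b.2 < kappa b.1)%N.
  by rewrite G0 add_stripE.
have {}inc (i : 'I_N) : (eta i + c i <= kappa i)%N by rewrite -add_stripE.
have topE b : (attach (c, g) b == r.+1 :> nat) = c b.1 && (b.2 == eta b.1 :> nat).
  by rewrite aE; case: ifP => _; rewrite ?eqxx //; have := G2 b; lia.
split=> //.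
- by apply/forallP => i; apply: leq_trans (inc i); apply: leq_addr.
- apply/flagged_onP; split => [b | b | b | b b' | b b']; rewrite !aE.
  + have := G0 b; have := inc b.1.
    by case: (c b.1) => /=; [case: eqP => /= |]; lia.
  + by case: ifP => [/andP[/cr]|].
  + by case: ifP => // _; have := G2 b; lia.
  + move=> b0 b'0 /[dup] adj /andP[/eqP e1 /eqP e2].
    have e1' : b'.1 = b.1 by apply/val_inj.
    move: b0 b'0; rewrite e1' e2.
    have := G0 b; have := G2 b'.
    case cb : (c b.1) => /=; last by move=> _ _ b0 b'0; apply: G3.
    case: eqP => [bE|bE]; case: eqP => [b'E|b'E] //=; try lia.
    by move=> _ _ b0 b'0; apply: G3.
  + move=> b0 b'0 /[dup] adj /andP[/eqP e1 /eqP e2].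
    have dij : (eta b'.1 + c b'.1 <= eta b.1 + c b.1)%N.
      by rewrite -!add_stripE e1; apply: cdec; rewrite -e1.
    move: b0 b'0; rewrite e2.
    have := G0 b; have := G2 b'.
    case cb : (c b.1) dij => /=; case cb' : (c b'.1) => /=.
    * case: eqP => [bE|bE]; case: eqP => [b'E|b'E] //=; try lia.
      by move=> _ _ _ b0 b'0; apply: G4.
    * case: eqP => [bE|bE] //=; try lia.
      by move=> _ _ _ b0 b'0; apply: G4.
    * case: eqP => [b'E|b'E] //=; try lia.
      by move=> _ _ _ b0 b'0; apply: G4.
    * by move=> _ _ _ b0 b'0; apply: G4.
- congr (_, _); apply/ffunP => b; rewrite ffunE.
    apply/existsP/idP => [[j /andP[_]] | cb].
      by rewrite topE => /andP[].
    have jM : (eta b < M)%N.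
      by apply: leq_trans (kappaM (ltn_ord b)); have := inc b; rewrite cb; lia.
    by exists (Ordinal jM); rewrite topE /= cb !eqxx.
  rewrite topE; case: ifP => H; last by rewrite ffunE /= H.
  apply/val_inj; rewrite /= val0; case/andP: H => cb /eqP bE.
  by have := G0 b; rewrite cb bE addn1 ltnn /=; lia.
Qed.

Variable R : comNzRingType.
Variable t : nat -> R.

Lemma E_on_peel :
  E_on N M r.+1 eta kappa t =
  \sum_(c : {ffun 'I_N -> bool} | strip_on r eta c)
    t r ^+ (\sum_i c i) * E_on N M r (add_strip eta c) kappa t.
Proof.
(* With the inclusion test moved into the summation predicate, the right side becomes a single sum
   over pairs (c, g), to be matched by [attach] and [detach]. *)
have EE r' e : E_on N M r' e kappa t = \sum_(g : {ffun 'I_N * 'I_M -> 'I_N} |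
    [forall i : 'I_N, e i <= kappa i]%N && flagged_on r' e kappa g)
    \prod_b (if (0 < g b)%N then t (g b).-1 else 1).
  by rewrite /E_on; case: ifP => //= _; rewrite big_pred0.
under [RHS]eq_bigr => c _ do rewrite EE big_distrr /=.
rewrite EE pair_big_dep /=.
rewrite (reindex_onto attach detach); last first.
  by move=> g /andP[inc fl]; have [] := detach_valid inc fl.
apply: eq_big => [[c g] | [c g]] /=.
  apply/andP/and3P => [[/andP[inc fl] /eqP cgE] | [c1 c2 c3]].
    by have := detach_valid inc fl; rewrite cgE => -[].
  by have [-> -> -> _] := attach_valid c1 c2 c3.
case/andP => /andP[inc fl] /eqP cgE.
have [c1 c2 c3 _] := detach_valid inc fl.
rewrite cgE /= in c1 c2 c3.
have [_ _ _ aE] := attach_valid c1 c2 c3.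
have /flagged_onP[G0 _ _ _ _] := c3.
rewrite -prodrXr !prod_cells /=.
rewrite -big_split /=; apply: eq_bigr => i _.
case ci : (c i); last first.
  by rewrite expr0 mul1r; apply: eq_bigr => j _; rewrite aE /= ci.
have jM : (eta i < M)%N.
  apply: leq_trans (kappaM (ltn_ord i)).
  by have /forallP/(_ i) := c2; rewrite add_stripE ci addn1.
(* The cell at column [eta i] carries [r.+1] in the attached filling and so gives [t r]; in [g] it
   lies outside the remaining shape and gives 1. *)
rewrite (bigD1 (Ordinal jM)) //= [in RHS](bigD1 (Ordinal jM)) //=.
have -> : (0 < g (i, Ordinal jM))%N = false.
  by rewrite G0 add_stripE ci /= addn1 ltnn.
rewrite aE /= ci eqxx /= expr1 mul1r; congr (_ * _).
apply: eq_bigr => j jE; rewrite aE /= ci /=.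
by rewrite -val_eqE /= in jE; rewrite (negPf jE).
Qed.

End Peel.

(** * Alternants *)

Section Determinants.
Variables (R : comNzRingType) (n : nat).

Lemma det_sum_rows (A : finType) (F : 'I_n -> A -> 'I_n -> R) :
  \det (\matrix_(i, j) \sum_a F i a j) =
  \sum_(f : {ffun 'I_n -> A}) \det (\matrix_(i, j) F i (f i) j).
Proof.
rewrite /determinant exchange_big /=; apply: eq_bigr => s _.
under eq_bigr => i _ do rewrite mxE.
rewrite bigA_distr_bigA big_distrr /=; apply: eq_bigr => f _.
by congr (_ * _); apply: eq_bigr => i _; rewrite mxE.
Qed.

Lemma det_scale_rows (k : 'I_n -> R) (F : 'I_n -> 'I_n -> R) :
  \det (\matrix_(i, j) (k i * F i j)) = (\prod_i k i) * \det (\matrix_(i, j) F i j).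
Proof.
rewrite /determinant big_distrr /=; apply: eq_bigr => s _.
rewrite mulrCA; congr (_ * _); rewrite -big_split /=.
by apply: eq_bigr => i _; rewrite !mxE.
Qed.

Lemma det_scale_cols (k : 'I_n -> R) (F : 'I_n -> 'I_n -> R) :
  \det (\matrix_(i, j) (k j * F i j)) = (\prod_j k j) * \det (\matrix_(i, j) F i j).
Proof.
rewrite -det_tr -[\det (\matrix_(i, j) F i j)]det_tr.
rewrite -[RHS](_ : \det (\matrix_(i, j) (k i * (\matrix_(i, j) F i j)^T i j)) = _).
  by congr (\det _); apply/matrixP => i j; rewrite !mxE.
rewrite det_scale_rows; congr (_ * \det _).
by apply/matrixP => i j; rewrite !mxE.
Qed.

End Determinants.

(** Shapes summed over live in a finite type, which bounds rows and parts; padding by 0 lets them be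
    used where a function on [nat] is expected. *)
Definition shape_fun n M (rho : {ffun 'I_n -> 'I_M.+1}) (i : nat) : nat :=
  oapp (fun i => rho i : nat) 0%N (insub i).

Lemma shape_funE n M (rho : {ffun 'I_n -> 'I_M.+1}) (i : 'I_n) :
  shape_fun rho i = rho i.
Proof. by rewrite /shape_fun valK. Qed.

Lemma shape_fun_le n M (rho : {ffun 'I_n -> 'I_M.+1}) i :
  (shape_fun rho i <= M)%N.
Proof. by rewrite /shape_fun; case: insub => //= j; rewrite -ltnS. Qed.

Section Alternants.
Variables (R : comNzRingType) (n : nat).
Implicit Types (mu : nat -> nat) (x t : nat -> R).

(* With r >= n this is the bialternant numerator of G_mu(x; t), and with r = 0
   that of s_mu(x). *)
Definition refined_alternant r mu x t : R :=
  \det (\matrix_(i < n, j < n)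
    (x j ^+ (mu i + (n - i.+1)) * \prod_(s < minn i r) (1 - t s * x j))).

Lemma eq_alternant r mu mu' x t : (forall i, (i < n)%N -> mu i = mu' i) ->
  refined_alternant r mu x t = refined_alternant r mu' x t.
Proof.
by move=> E; congr (\det _); apply/matrixP => i j; rewrite !mxE E.
Qed.

(** In a row i > r, the factor 1 - t_r x_j either leaves the exponent alone or raises it by one at
    the cost of -t_r, that is, adds a box to row i. Multilinearity sums over all choices of rows;
    those not giving a partition raise row i+1 but not row i when mu_i = mu_(i+1), and then two rows
    of the determinant coincide. *)
Lemma alternant_peel r mu x t : dec_on n mu ->
  refined_alternant r.+1 mu x t =
  \sum_(c : {ffun 'I_n -> bool} | strip_on r mu c)
    (- t r) ^+ (\sum_i c i) * refined_alternant r (add_strip mu c) x t.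
Proof.
move=> mudec.
pose k (i : 'I_n) (c : bool) : R := if c then (if (r < i)%N then - t r else 0) else 1.
pose F (i : 'I_n) (c : bool) (j : 'I_n) : R :=
  x j ^+ (mu i + c + (n - i.+1)) * \prod_(s < minn i r) (1 - t s * x j).
rewrite [LHS](_ : _ = \det (\matrix_(i, j) \sum_c k i c * F i c j)); last first.
  congr (\det _); apply/matrixP => i j; rewrite !mxE big_bool /k /F /=.
  rewrite addn0 mul1r; case: (ltnP r i) => ri; last first.
    by rewrite mul0r add0r; congr (_ * _); rewrite !(minn_idPl _) // leqW.
  rewrite !(minn_idPr _) // 1?ltnW // big_ord_recr /= addn1 addSn exprS.
  by ring.
rewrite det_sum_rows (bigID (strip_on r mu)) /= [X in _ + X]big1 ?addr0; last first.
  move=> c /nandP[/forallPn[i] | /forallPn[i /forallPn[j]]].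
    rewrite negb_imply => /andP[ci ri].
    rewrite (det_scale_rows (fun i => k i (c i)) (fun i => F i (c i))).
    by rewrite (bigD1 i) //= /k ci (negPf ri) !mul0r.
  rewrite negb_imply => /andP[/eqP ji]; rewrite -ltnNge !add_stripE => lt.
  have dij : (mu j <= mu i)%N by rewrite ji; apply: dec_onS mudec _; rewrite -ji.
  have [ci cj] : c i = false /\ c j = true.
    by move: lt; case: (c i); case: (c j) => //=; lia.
  have eij : mu j = mu i by move: lt; rewrite ci cj; lia.
  rewrite (det_scale_rows (fun i => k i (c i)) (fun i => F i (c i))).
  (* If j <= r, the scalar of row j is 0. Otherwise i >= r as well, so both rows have the same
     product over s < r and the same exponent. *)
  case: (ltnP r j) => rj; last first.
    by rewrite (bigD1 j) //= /k cj ltnNge rj !mul0r.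
  rewrite [X in _ * X](determinant_alternate (i1 := i) (i2 := j)) ?mulr0 //.
    by rewrite -val_eqE /= ji neq_ltn ltnSn.
  move=> l; rewrite !mxE /F ci cj eij ji; congr (_ ^+ _ * _).
    by have := ltn_ord j; rewrite ji; lia.
  by rewrite !(minn_idPr _) //; lia.
apply: eq_bigr => c /andP[/forallP cr _].
rewrite (det_scale_rows (fun i => k i (c i)) (fun i => F i (c i))) -prodrXr.
congr (_ * _).
  apply: eq_bigr => i _; rewrite /k; case ci : (c i) => //=.
  by have := cr i; rewrite ci /= => ->.
by congr (\det _); apply/matrixP => i j; rewrite !mxE add_stripE.
Qed.

(** With no variable allowed, [g] vanishes everywhere, so kappa/mu has no cell in the rectangle; the
    bound on kappa ensures that no cell lies beyond it. *)
Lemma E_on0 M mu kappa t :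
  (forall i, (i < n)%N -> (kappa i <= M)%N) ->
  E_on n M 0 mu kappa t = [forall i : 'I_n, mu i == kappa i]%:R.
Proof.
move=> kM; rewrite /E_on.
case: forallP => [inc | ninc]; last first.
  case: forallP => // E; case: ninc => i; by rewrite (eqP (E i)).
case: forallP => [E | /forallP/forallPn[i ne]].
  have v0 (b : 'I_n * 'I_M) : insubd b.1 0%N = 0%N :> nat.
    by rewrite val_insubd (leq_ltn_trans (leq0n _) (ltn_ord b.1)).
  rewrite (big_pred1 [ffun b : 'I_n * 'I_M => insubd b.1 0%N]); last first.
    move=> g; apply/flagged_onP/eqP => [[_ _ G _ _] | ->].
      by apply/ffunP => b; apply/val_inj; rewrite ffunE /= v0; apply/eqP; rewrite -leqn0.
    split=> [b | b | b | b b' | b b']; rewrite !ffunE !v0 //.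
    by rewrite (eqP (E b.1)); lia.
  by rewrite big1 // => b _; rewrite ffunE v0.
rewrite big_pred0 // => g; apply/flagged_onP => -[G0 _ G _ _].
have lt : (mu i < kappa i)%N by rewrite ltn_neqAle ne inc.
have iM : (mu i < M)%N by apply: leq_trans lt (kM _ _).
by have := G0 (i, Ordinal iM); rewrite /= leqnn lt ltnNge G.
Qed.

Lemma alternant_E M r mu x t :
  dec_on n mu -> (forall i, (i < n)%N -> (mu i <= M)%N) ->
  refined_alternant r mu x t =
  \sum_(kappa : {ffun 'I_n -> 'I_M.+1} | dec_on n (shape_fun kappa))
    E_on n M r mu (shape_fun kappa) (fun i => - t i)
    * refined_alternant 0 (shape_fun kappa) x t.
Proof.
elim: r mu => [|r IHr] mu mudec muM.
  pose kappa0 : {ffun 'I_n -> 'I_M.+1} := [ffun i : 'I_n => inord (mu i)].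
  have k0E i : (i < n)%N -> shape_fun kappa0 i = mu i.
    move=> lt; rewrite (shape_funE kappa0 (Ordinal lt)) ffunE /= inordK //.
    by rewrite ltnS muM.
  rewrite (bigD1 kappa0) /=; last first.
    by apply/dec_onP => i lt; rewrite (k0E _ lt) (k0E _ (ltnW lt)) (dec_onS mudec).
  rewrite E_on0; last by move=> i _; apply: shape_fun_le.
  rewrite (_ : [forall i : 'I_n, _]) ?mul1r; last first.
    by apply/forallP => i; rewrite k0E.
  rewrite big1 ?addr0; first by apply: eq_alternant => i /k0E.
  move=> kappa /andP[_ ne]; rewrite E_on0; last by move=> i _; apply: shape_fun_le.
  case: forallP; rewrite ?mul0r // => E; case/eqP: ne; apply/ffunP => i.
  by apply/val_inj; rewrite /= -shape_funE -(eqP (E i)) -k0E ?shape_funE.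
rewrite alternant_peel //.
under [RHS]eq_bigr => kappa kdec.
  rewrite E_on_peel //; last by move=> i _; apply: shape_fun_le.
  rewrite big_distrl /=.
  over.
rewrite /= exchange_big /=; apply: eq_bigr => c /[dup] cs /andP[/forallP cr cdec].
rewrite (IHr _ cdec); last first.
  (* A strip never meets row 0, so the first part does not grow and the bound M survives for all
     parts. *)
  elim=> [|i IHi] lt.
    have := cr (Ordinal lt); rewrite ltn0 implybF.
    rewrite (add_stripE mu c (Ordinal lt)) => /negPf -> /=.
    by rewrite addn0 muM.
  exact: leq_trans (dec_onS cdec lt) (IHi (ltnW lt)).
by rewrite big_distrr /=; apply: eq_bigr => kappa _; rewrite mulrA.
Qed.

End Alternants.

(** * Branching rule for set-valued tableaux *)

Lemma card_ord_lt M m : (m <= M)%N -> #|[set k : 'I_M | k < m]%N| = m.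
Proof.
by move=> mM; rewrite -sum1dep_card -(big_ord_widen M (fun=> 1%N) mM) sum1_card card_ord.
Qed.

Lemma card_ord_itv M l m :
  (l <= m <= M)%N -> #|[set k : 'I_M | l <= k < m]%N| = (m - l)%N.
Proof.
case/andP=> lm mM; have := cardsID [set k : 'I_M | k < l]%N [set k : 'I_M | k < m]%N.
rewrite card_ord_lt // => E.
rewrite -[X in (X - l)%N]E (_ : _ :&: _ = [set k : 'I_M | k < l]%N).
  rewrite card_ord_lt ?(leq_trans lm) // addKn; apply: eq_card => k.
  by rewrite !inE -leqNgt.
by apply/setP => k; rewrite !inE; lia.
Qed.

Lemma initial_segment M (A : {set 'I_M}) :
  (forall j k : 'I_M, k = j.+1 :> nat -> k \in A -> j \in A) ->
  forall j, (j \in A) = (j < #|A|)%N.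
Proof.
move=> down.
have downs d (j k : 'I_M) : (j + d = k)%N -> k \in A -> j \in A.
  elim: d j => [|d IHd] j jk kA.
    by rewrite (_ : j = k) //; apply/val_inj; rewrite /= -jk addn0.
  have jM : (j.+1 < M)%N by apply: leq_ltn_trans (ltn_ord k); lia.
  by apply: (down _ (Ordinal jM)) => //; apply: IHd kA => /=; lia.
move=> j; apply/idP/idP => [jA | ].
  rewrite -(card_ord_lt (ltn_ord j)); apply/subset_leq_card/subsetP => k.
  by rewrite inE ltnS => kj; apply: (downs (j - k)%N _ _ _ jA); rewrite subnKC.
apply: contraTT => jA; rewrite -leqNgt -[leqRHS](card_ord_lt (ltnW (ltn_ord j))).
apply/subset_leq_card/subsetP => k kA; rewrite inE ltnNge.
apply: contra jA => jk; by apply: (downs (k - j)%N _ _ _ kA); rewrite subnKC.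
Qed.

Section Branching.
Variables (N M n : nat) (mu : nat -> nat).
Hypothesis mu_dec : dec_on N mu.
Hypothesis muM : forall i, (i < N)%N -> (mu i <= M)%N.
Hypothesis mu0 : forall i, (N <= i)%N -> mu i = 0%N.

Notation shapeT := {ffun 'I_N -> 'I_M.+1}.
Notation choiceT := {ffun 'I_N -> bool}.
Notation svtT n := {ffun 'I_N * 'I_M -> {set 'I_n}}.

Definition interlacing (rho : shapeT) : bool :=
  [forall i : 'I_N, mu i.+1 <= rho i <= mu i]%N.

(** The last box of row i of rho may also hold the largest letter only if mu has no box below it.
    The strict inequality also guarantees that this last box exists. *)
Definition removable (rho : shapeT) (c : choiceT) : bool :=
  [forall i : 'I_N, c i ==> (mu i.+1 < rho i)%N].

(* The boxes containing the largest letter: those outside of rho, and the last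
   box of each row of rho selected by c. *)
Let has_max (rho : shapeT) (c : choiceT) (b : 'I_N * 'I_M) : bool :=
  (rho b.1 <= b.2 < mu b.1)%N || c b.1 && (b.2.+1 == rho b.1 :> nat).

Let attach (p : (shapeT * choiceT) * svtT n) : svtT n.+1 :=
  [ffun b => (lift ord_max @: p.2 b)
     :|: (if has_max p.1.1 p.1.2 b then [set ord_max] else set0)].

Let low (T : svtT n.+1) : svtT n := [ffun b => lift ord_max @^-1: T b].
Let low_shape (T : svtT n.+1) : shapeT :=
  [ffun i => inord #|[set j | low T (i, j) != set0]|].
Let low_choice (T : svtT n.+1) : choiceT :=
  [ffun i : 'I_N => [exists j : 'I_M, (j.+1 == low_shape T i :> nat) && (ord_max \in T (i, j))]].

Let detach (T : svtT n.+1) := ((low_shape T, low_choice T), low T).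

Let mem_low (T : svtT n.+1) b a : (a \in low T b) = (lift ord_max a \in T b).
Proof. by rewrite ffunE inE. Qed.

Let attach_lift p b a : (lift ord_max a \in attach p b) = (a \in p.2 b).
Proof.
rewrite ffunE in_setU mem_imset; last exact: lift_inj.
case: ifP => _; rewrite !inE ?orbF //.
by rewrite eq_sym (negPf (neq_lift _ _)) orbF.
Qed.

Let attach_max p b : (ord_max \in attach p b) = has_max p.1.1 p.1.2 b.
Proof.
rewrite ffunE in_setU; case: ifP => _; first by rewrite inE eqxx orbT.
rewrite inE orbF; apply/negbTE/imsetP => -[a _ /eqP].
by rewrite (negPf (neq_lift _ _)).
Qed.

(** A box above another box of mu contains a letter that is not the largest, whence mu_(i+1) <=
    rho_i. If the largest letter shares a box with smaller ones, the next box to the right has no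
    smaller letter, so the box ends its row of rho; and no box of mu can be below it. *)
Lemma svt_detach T : svt_on mu T ->
  [/\ interlacing (low_shape T), removable (low_shape T) (low_choice T),
      svt_on (shape_fun (low_shape T)) (low T) & attach (detach T) = T].
Proof.
move/svt_onP => [S0 S1 S2].
have lowP b : reflect (exists a, lift ord_max a \in T b) (low T b != set0).
  apply: (iffP (set0Pn _)) => [[a] | [a aT]]; first by rewrite mem_low; exists a.
  by exists a; rewrite mem_low.
have down b (r : 'I_n.+1) (s : 'I_n) : (r <= s)%N -> r \in T b -> low T b != set0.
  move=> rs rT; apply/lowP; case: (unliftP ord_max r) => [a rE | rE].
    by exists a; rewrite -rE.
  by move: rs; rewrite rE /= leqNgt ltn_ord.
have rowE (i : 'I_N) (j : 'I_M) : (low T (i, j) != set0) = (j < low_shape T i)%N.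
  have cM : (#|[set j | low T (i, j) != set0]| < M.+1)%N.
    by rewrite ltnS -[leqRHS]card_ord max_card.
  rewrite [low_shape T i]ffunE inordK // -initial_segment ?inE // => {cM}{}j k kj.
  rewrite !inE => /lowP[a aT].
  have : T (i, j) != set0.
    have : T (i, k) != set0 by apply/set0Pn; exists (lift ord_max a).
    by rewrite !S0 /= kj; apply: ltnW.
  case/set0Pn => r rT; apply: (down _ r a) => //.
  have -> : a = lift ord_max a :> nat by rewrite lift_max.
  by apply: S1 rT aT; rewrite /adj_right kj !eqxx.
have low_le (i : 'I_N) : (low_shape T i <= mu i)%N.
  rewrite leqNgt; apply/negP => lt.
  have jM : (mu i < M)%N by apply: leq_trans lt _; rewrite -ltnS.
  have : low T (i, Ordinal jM) != set0 by rewrite rowE.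
  case/lowP => a aT; have : T (i, Ordinal jM) != set0 by apply/set0Pn; exists (lift ord_max a).
  by rewrite S0 ltnn.
have ge_low (i : 'I_N) : (mu i.+1 <= low_shape T i)%N.
  case: (posnP (mu i.+1)) => [-> // | pos].
  have iN : (i.+1 < N)%N by rewrite ltnNge; apply/negP => /mu0 E; rewrite E in pos.
  have jM : ((mu i.+1).-1 < M)%N by have := muM iN; lia.
  rewrite -(prednK pos) -[X in (X < _)%N]/(Ordinal jM : nat) -rowE.
  have : T (Ordinal iN, Ordinal jM) != set0 by rewrite S0 /= prednK.
  case/set0Pn => s sT.
  have : T (i, Ordinal jM) != set0.
    by rewrite S0 /=; have := dec_onS mu_dec iN; lia.
  case/set0Pn => r rT; have := S2 (i, Ordinal jM) (Ordinal iN, Ordinal jM).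
  rewrite /adj_below !eqxx => /(_ isT _ _ rT sT) rs.
  have rn : (r < n)%N by have := ltn_ord s; lia.
  apply/lowP; exists (Ordinal rn); rewrite (_ : lift _ _ = r) //.
  by apply/val_inj; rewrite [LHS]lift_max.
have maxE b : (ord_max \in T b) = has_max (low_shape T) (low_choice T) b.
  case: b => i j; apply/idP/orP => /= [maxT | [/andP[ge lt] | /andP[]]].
  - have jmu : (j < mu i)%N by rewrite -(S0 (i, j)); apply/set0Pn; exists ord_max.
    case: (leqP (low_shape T i) j) => [le | lt]; first by left.
    right; suff jE : j.+1 == low_shape T i :> nat.
      by rewrite jE andbT ffunE; apply/existsP; exists j; rewrite jE.
    rewrite eqn_leq lt leqNgt; apply/negP => lt'.
    have jM : (j.+1 < M)%N by apply: leq_trans lt' _; rewrite -ltnS.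
    have : low T (i, Ordinal jM) != set0 by rewrite rowE.
    case/lowP => a aT; have := S1 (i, j) (i, Ordinal jM).
    rewrite /adj_right !eqxx => /(_ isT _ _ maxT aT).
    by rewrite lift_max leqNgt ltn_ord.
  - have /set0Pn[r rT] : T (i, j) != set0 by rewrite S0.
    case: (unliftP ord_max r) rT => [a -> aT | -> //].
    have : low T (i, j) != set0 by apply/lowP; exists a.
    by rewrite rowE ltnNge ge.
  - rewrite {1}ffunE => /existsP[k /andP[/eqP kE kT]] /eqP jE.
    by rewrite (_ : j = k) //; apply/val_inj => /=; lia.
split.
- by apply/forallP => i; rewrite ge_low low_le.
- apply/forallP => i; apply/implyP; rewrite ffunE => /existsP[j /andP[/eqP jE jT]].
  rewrite ltnNge; apply/negP => le.
  have iN : (i.+1 < N)%N by rewrite ltnNge; apply/negP => /mu0 E; move: le; rewrite E -jE.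
  have /set0Pn[s sT] : T (Ordinal iN, j) != set0 by rewrite S0 /= jE.
  have := S2 (i, j) (Ordinal iN, j); rewrite /adj_below !eqxx => /(_ isT _ _ jT sT).
  by rewrite ltnNge -ltnS ltn_ord.
- apply/svt_onP; split=> [[i j] | b c bc r s | b c bc r s].
  + by rewrite rowE /= shape_funE.
  + by rewrite !mem_low => rT sT; have := S1 _ _ bc _ _ rT sT; rewrite !lift_max.
  + by rewrite !mem_low => rT sT; have := S2 _ _ bc _ _ rT sT; rewrite !lift_max.
- apply/ffunP => b; apply/setP => r; case: (unliftP ord_max r) => [a -> | ->].
    by rewrite attach_lift mem_low.
  by rewrite attach_max maxE.
Qed.

Lemma svt_attach rho c T :
  interlacing rho -> removable rho c -> svt_on (shape_fun rho) T ->
  svt_on mu (attach ((rho, c), T)) /\ detach (attach ((rho, c), T)) = ((rho, c), T).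
Proof.
move=> /forallP inter /forallP rem /svt_onP[S0 S1 S2].
have {}rem (i : 'I_N) : c i -> (mu i.+1 < rho i)%N by apply/implyP.
have {}S0 (b : 'I_N * 'I_M) : (T b != set0) = (b.2 < rho b.1)%N by rewrite S0 shape_funE.
have in_rho b a : a \in T b -> (b.2 < rho b.1)%N.
  by move=> aT; rewrite -S0; apply/set0Pn; exists a.
have low_attach : low (attach ((rho, c), T)) = T.
  by apply/ffunP => b; apply/setP => a; rewrite mem_low attach_lift.
have shape_attach : low_shape (attach ((rho, c), T)) = rho.
  apply/ffunP => i; rewrite ffunE low_attach; apply/val_inj.
  have -> : #|[set j | T (i, j) != set0]| = rho i.
    rewrite -[RHS](@card_ord_lt M); last by rewrite -ltnS.
    by apply: eq_card => j; rewrite !inE S0.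
  by rewrite /= inordK.
have at0 (b : 'I_N * 'I_M) : (attach ((rho, c), T) b != set0) = (b.2 < mu b.1)%N.
  have interb := inter b.1; have remb := rem b.1.
  apply/set0Pn/idP => [[r] | lt].
    case: (unliftP ord_max r) => [a -> | ->].
      by rewrite attach_lift => /in_rho lt; apply: leq_trans lt _; case/andP: interb.
    rewrite attach_max => /orP[/andP[]|/andP[_ /eqP jE]] //=.
    by rewrite jE; case/andP: interb.
  case: (leqP (rho b.1) b.2) => [le | lt'].
    by exists ord_max; rewrite attach_max /has_max /= le lt.
  by move: lt'; rewrite -S0 => /set0Pn[a aT]; exists (lift ord_max a); rewrite attach_lift.
split.
  apply/svt_onP; split=> // b b' /[dup] bb' /andP[/eqP b1 /eqP b2] r s.
    case: (unliftP ord_max s) => [a' -> | -> _ _]; last by rewrite /= -ltnS.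
    case: (unliftP ord_max r) => [a -> | ->]; rewrite !(attach_lift, attach_max).
      by rewrite !lift_max; apply: S1.
    move=> + /in_rho; have -> : b'.1 = b.1 by apply/val_inj.
    rewrite b2 /has_max /= => mb lt; case/orP: mb => /andP[].
      by move=> le; rewrite ltnNge (leq_trans le) // in lt.
    by move=> _ /eqP jE; rewrite jE ltnn in lt.
  case: (unliftP ord_max r) => [a -> | ->]; rewrite !(attach_lift, attach_max).
    case: (unliftP ord_max s) => [a' -> | -> _ _]; last by rewrite lift_max /=.
    by rewrite !(attach_lift, attach_max) !lift_max; apply: S2.
  move=> mb sb; have : attach ((rho, c), T) b' != set0 by apply/set0Pn; exists s.
  rewrite at0 b1 b2 => lt; have /andP[le _] := inter b.1.
  case/orP: mb => /andP[]; first by rewrite leqNgt (leq_trans lt le).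
  by move=> /= /rem + /eqP jE; rewrite -jE ltnS leqNgt lt.
rewrite /detach low_attach shape_attach; congr (_, _, _).
apply/ffunP => i; rewrite ffunE shape_attach; apply/existsP/idP.
  move=> [j /andP[/eqP jE]]; rewrite attach_max /has_max /= jE eqxx andbT => /orP[] //.
  by rewrite -jE ltnn.
move=> ci; have lt := rem _ ci.
have jM : ((rho i).-1 < M)%N by have := ltn_ord (rho i); lia.
exists (Ordinal jM); rewrite attach_max /has_max /= ci prednK ?eqxx ?orbT //.
by lia.
Qed.

Variable R : comNzRingType.
Variables x t : nat -> R.

Lemma box_weight_attach rho c (T : svtT n) (b : 'I_N * 'I_M) :
  box_weight x t b.1 (attach ((rho, c), T) b) =
  box_weight x t b.1 (T b) *
  (if has_max rho c b then x n * (if T b == set0 then 1 else - t b.1) else 1).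
Proof.
have injl : injective (lift ord_max : 'I_n -> 'I_n.+1) by apply: lift_inj.
have sumE : \prod_(r in [set lift ord_max a | a in T b]) x r = \prod_(a in T b) x a.
  rewrite big_imset; last by move=> ? ? _ _ /injl.
  by apply: eq_bigr => a _; rewrite lift_max.
rewrite /box_weight ffunE /=; case: ifP => _; last first.
  by rewrite setU0 card_imset // sumE mulr1.
have maxn : ord_max \notin [set lift ord_max a | a in T b].
  by apply/imsetP => -[a _ /eqP]; rewrite (negPf (neq_lift _ _)).
rewrite setUC cardsU1 maxn card_imset // big_setU1 //= sumE add1n subn1 /=.
case: eqVneq => [-> | ne]; first by rewrite cards0 !expr0 big_set0; ring.
have pos : (0 < #|T b|)%N by rewrite card_gt0.
by rewrite -{1}(prednK pos) exprS subn1; ring.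
Qed.

(** For fixed rho, the rows decide independently whether the last box of rho also receives the
    largest letter. There it is an extra entry and costs -t_i x_n, so summing over the two options
    gives 1 - t_i x_n. *)
Lemma groth_on_branch :
  groth_on N M n.+1 mu x t =
  \sum_(rho | interlacing rho)
    (\prod_(i < N) (x n ^+ (mu i - rho i)
                    * (if (mu i.+1 < rho i)%N then 1 - t i * x n else 1)))
    * groth_on N M n (shape_fun rho) x t.
Proof.
pose k (i : 'I_N) (c : bool) : R := if c then - t i * x n else 1.
have sum_choice (rho : shapeT) :
    \prod_(i < N) (x n ^+ (mu i - rho i)
                    * (if (mu i.+1 < rho i)%N then 1 - t i * x n else 1)) =
    \sum_(c | removable rho c) \prod_(i < N) (x n ^+ (mu i - rho i) * k i (c i)).
  rewrite (eq_bigl (fun c : choiceT =>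
    c \in family (fun (i : 'I_N) (a : bool) => a ==> (mu i.+1 < rho i)%N))); last first.
    by move=> c; apply: eq_forallb => i.
  rewrite -(bigA_distr_big_dep _ (fun (i : 'I_N) (a : bool) => x n ^+ (mu i - rho i) * k i a)).
  apply: eq_bigr => i _; rewrite big_mkcond big_bool /= /k.
  by case: ifP => _ /=; ring.
under [RHS]eq_bigr => rho _.
  rewrite sum_choice big_distrl /=.
  under eq_bigr => c _ do rewrite big_distrr /=.
  over.
rewrite pair_big_dep /= pair_big_dep /=.
rewrite [LHS](reindex_onto attach detach); last by move=> T /svt_detach[].
apply: eq_big => [[[rho c] T] | [[rho c] T]] /=.
  apply/andP/idP => [[sT /eqP E] | /andP[/andP[h1 h2] h3]].
    by have [] := svt_detach sT; case: E => -> -> -> -> -> ->.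
  by have [-> ->] := svt_attach h1 h2 h3.
case/andP=> sT /eqP E; have [h1 h2 /svt_onP[S0 _ _] _] := svt_detach sT.
case: E h1 h2 S0 => -> -> -> /forallP inter /forallP rem S0.
rewrite !prod_cells -big_split /=; apply: eq_bigr => i _.
under eq_bigr => j _ do rewrite (box_weight_attach _ _ _ (i, j)) /=.
rewrite big_split /= mulrC; congr (_ * _).
have {}S0 j : (T (i, j) == set0) = (rho i <= j)%N.
  by apply: negb_inj; rewrite S0 /= shape_funE -ltnNge.
(* The two ways to receive the largest letter are disjoint: cells of mu outside rho are empty in T
   and give x_n, and the selected last box of rho is nonempty and gives -t_i x_n. *)
transitivity ((\prod_(j < M) if (rho i <= j < mu i)%N then x n else 1) *
   \prod_(j < M) (if c i && (j.+1 == rho i :> nat) then - t i * x n else 1)).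
  rewrite -big_split /=; apply: eq_bigr => j _; rewrite S0 /has_max /=.
  case: (leqP (rho i) j) => rj /=; last first.
    by case: ifP => _; ring.
  rewrite (_ : (j.+1 == rho i :> nat) = false); last by lia.
  by rewrite andbF orbF; case: ifP => _; rewrite !mulr1.
have := inter i => /andP[le1 le2]; congr (_ * _).
  rewrite -big_mkcond /= prodr_const; congr (_ ^+ _).
  rewrite -(@card_ord_itv M) ?le2 ?muM //.
  by apply: eq_card => j; rewrite inE.
rewrite /k; case ci : (c i) => /=; last by rewrite big1.
have lt := rem i; rewrite ci /= in lt.
have rho0 : (0 < rho i)%N := leq_ltn_trans (leq0n _) lt.
have jM : ((rho i).-1 < M)%N by rewrite prednK // -ltnS.
rewrite (bigD1 (Ordinal jM)) //= prednK // eqxx.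
rewrite big1 ?mulr1 // => j jE; case: eqP => // jr; case/eqP: jE.
by apply/val_inj => /=; lia.
Qed.

End Branching.

(** * Branching rule for alternants *)

(** A deformation of the factorization of X^(d+1) - y^(d+1), which is the case u = 0. It is used
    with X = x_j, y = x_n, u = t_i and d = mu_i - mu_(i+1); the index b is rho_i - mu_(i+1), so the
    test 0 < b is the condition for [removable]. *)
Lemma refined_geometric_sum (R : comNzRingType) (X y u : R) d :
  (1 - u * y) * X ^+ d.+1 - y ^+ d.+1 * (1 - u * X) =
  (X - y) * \sum_(b < d.+1) y ^+ (d - b) * (if (0 < b)%N then 1 - u * y else 1) * X ^+ b.
Proof.
elim: d => [|d IHd]; first by rewrite big_ord_recr big_ord0 /= subnn !expr0; ring.
rewrite big_ord_recr /= subnn expr0 mul1r [(X - y) * _]mulrDr.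
rewrite (_ : \sum_(b < d.+1) _ = y * \sum_(b < d.+1)
    y ^+ (d - b) * (if (0 < b)%N then 1 - u * y else 1) * X ^+ b); last first.
  rewrite big_distrr; apply: eq_bigr => b _ /=.
  by rewrite subSn 1?leq_ord // exprS !mulrA.
by rewrite [(X - y) * (y * _)]mulrCA -IHd; rewrite ![_ ^+ d.+2]exprS; ring.
Qed.

Lemma sum_ord_itv (R : comNzRingType) M l m (f : nat -> R) :
  (l <= m <= M)%N ->
  \sum_(a < M.+1 | (l <= a <= m)%N) f a = \sum_(b < (m - l).+1) f (l + b)%N.
Proof.
case/andP=> lm mM.
transitivity (\sum_(l <= a < m.+1) f a).
  rewrite (big_nat_widen _ _ M.+1) ?ltnS // (big_nat_widenl _ 0) // big_mkord.
  by apply: eq_bigl => a; rewrite /= ltnS andbC.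
rewrite -{1}[l]add0n big_addn subSn // big_mkord.
by apply: eq_bigr => b _; rewrite addnC.
Qed.

Definition vdm (R : comNzRingType) n (x : nat -> R) : R :=
  \prod_(i < n) \prod_(j < n | (i < j)%N) (x i - x j).

Lemma vdmS (R : comNzRingType) n (x : nat -> R) :
  vdm n.+1 x = vdm n x * \prod_(i < n) (x i - x n).
Proof.
rewrite /vdm big_ord_recr /= [X in _ * X]big_pred0 ?mulr1; last first.
  by move=> j; rewrite ltnNge -ltnS ltn_ord.
rewrite -big_split /=; apply: eq_bigr => i _.
by rewrite big_mkcond big_ord_recr /= ltn_ord -big_mkcond.
Qed.

Section AlternantBranching.
Variables (F : fieldType) (n M r : nat) (mu : nat -> nat) (x t : nat -> F).
Hypothesis nr : (n <= r)%N.
Hypothesis mu_dec : dec_on n.+1 mu.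
Hypothesis muM : forall i, (i < n)%N -> (mu i <= M)%N.
Hypothesis t_reg : forall i, (i < n)%N -> 1 - t i * x n != 0.

Let y := x n.
Let phi (i : nat) (z : F) := z ^+ (mu i + (n.+1 - i.+1)) * \prod_(s < minn i r) (1 - t s * z).
(** [phi i.+1] has one factor more than [phi i], namely 1 - t_i z. The coefficients are chosen so
    that at z = y both this factor and the power of y agree in the two terms, which then cancel. *)
Let red (i : nat) (z : F) :=
  (1 - t i * y) * phi i z - y ^+ (mu i - mu i.+1).+1 * phi i.+1 z.

Let red_matrix : 'M[F]_n.+1 :=
  \matrix_(i, j) if (i < n)%N then red i (x j) else phi i (x j).

Let det_red : \det red_matrix =
  (\prod_(i < n) (1 - t i * y)) * refined_alternant n.+1 r mu x t.
Proof.
pose L : 'M[F]_n.+1 := \matrix_(i, k)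
  if k == i then (if (i < n)%N then 1 - t i * y else 1)
  else if (k == i.+1 :> nat) then - y ^+ (mu i - mu i.+1).+1 else 0.
have detL : \det L = \prod_(i < n) (1 - t i * y).
  rewrite -det_tr det_trig; last first.
    apply/is_trig_mxP => i j ij; rewrite !mxE -val_eqE /=.
    by rewrite (ltn_eqF ij) ltn_eqF // ltnW.
  rewrite big_ord_recr /= !mxE eqxx ltnn mulr1.
  by apply: eq_bigr => i _; rewrite !mxE eqxx /= ltn_ord.
rewrite -detL -det_mulmx; congr (\det _); apply/matrixP => i j; rewrite !mxE.
rewrite (bigD1 i) //= !mxE eqxx.
case: ltnP => [lt | ge].
  rewrite (bigD1 (Ordinal (lt : i.+1 < n.+1)%N)) /=; last first.
    by rewrite -val_eqE /= neq_ltn ltnSn orbT.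
  rewrite !mxE -val_eqE /= gtn_eqF // eqxx [X in _ + (_ + X)]big1 ?addr0.
    by rewrite /red /phi mulNr.
  move=> k /andP[k1 k2]; rewrite !mxE (negPf k1).
  by rewrite -val_eqE /= in k2; rewrite (negPf k2) mul0r.
rewrite [X in _ + X]big1 ?addr0 ?mul1r // => k k1; rewrite !mxE (negPf k1) ltn_eqF ?mul0r //.
by rewrite ltnS (leq_trans _ ge) // -ltnS.
Qed.

Let red_y i : (i < n)%N -> red i y = 0.
Proof.
move=> lt; rewrite /red /phi.
have le := dec_onS mu_dec (lt : i.+1 < n.+1)%N.
rewrite (minn_idPl _) ?(minn_idPl _) //; try by apply: leq_trans nr; rewrite // ltnW.
rewrite big_ord_recr /= mulrA mulrA -exprD.
rewrite (_ : ((mu i - mu i.+1).+1 + (mu i.+1 + (n.+1 - i.+2)) =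
              mu i + (n.+1 - i.+1))%N); last by lia.
by ring.
Qed.

Let weight (i : 'I_n) (a : 'I_M.+1) : F :=
  if (mu i.+1 <= a <= mu i)%N
  then y ^+ (mu i - a) * (if (mu i.+1 < a)%N then 1 - t i * y else 1) else 0.

Let redE (i j : 'I_n) : red i (x j) = (x j - y) *
  \sum_(a < M.+1) weight i a *
     (x j ^+ (a + (n - i.+1)) * \prod_(s < minn i r) (1 - t s * x j)).
Proof.
have le := dec_onS mu_dec (ltn_ord i : i.+1 < n.+1)%N.
pose P := \prod_(s < minn i r) (1 - t s * x j).
pose g (a : nat) := y ^+ (mu i - a) * (if (mu i.+1 < a)%N then 1 - t i * y else 1) *
  (x j ^+ (a + (n - i.+1)) * P).
rewrite (eq_bigr (fun a : 'I_M.+1 => if (mu i.+1 <= a <= mu i)%N then g a else 0)); last first.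
  by move=> a _; rewrite /weight; case: ifP => // _; rewrite mul0r.
rewrite -big_mkcond (@sum_ord_itv _ M _ _ g) ?le ?muM //=.
rewrite (eq_bigr (fun b : 'I_(mu i - mu i.+1).+1 =>
  y ^+ (mu i - mu i.+1 - b) * (if (0 < b)%N then 1 - t i * y else 1) * x j ^+ b
   * (x j ^+ (mu i.+1 + (n - i.+1)) * P))); last first.
  move=> b _; rewrite /g subnDA.
  have -> : (mu i.+1 < mu i.+1 + b)%N = (0 < b)%N by lia.
  by rewrite (addnC (mu i.+1) b) -(addnA b) [x j ^+ (b + _)]exprD !mulrA.
rewrite -big_distrl /= mulrA -refined_geometric_sum /red /phi.
rewrite (minn_idPl _) ?(minn_idPl _) // ?(leq_trans (ltn_ord i)) //; last first.
  by rewrite ltnW // (leq_trans (ltn_ord i)).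
rewrite big_ord_recr /= -/P /P (minn_idPl _); last first.
  by rewrite ltnW // (leq_trans (ltn_ord i)).
rewrite subSS (_ : (mu i + (n - i) = (mu i - mu i.+1).+1 + (mu i.+1 + (n - i.+1)))%N).
  by rewrite subSS exprD; ring.
by have := ltn_ord i; lia.
Qed.

(** After the row operations only the bottom entry of the last column survives, and column j of its
    minor is divisible by x_j - x_n. Each remaining row is a sum over mu_(i+1) <= a <= mu_i,
    independently of the others, so the interlacing shapes appear directly, without cancellation. *)
Lemma alternant_branch :
  refined_alternant n.+1 r mu x t =
  (\prod_(i < n) (x i - x n)) * x n ^+ mu n *
  \sum_(rho : {ffun 'I_n -> 'I_M.+1} | interlacing mu rho)
    (\prod_(i < n) (x n ^+ (mu i - rho i)
                    * (if (mu i.+1 < rho i)%N then 1 - t i * x n else 1)))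
    * refined_alternant n r (shape_fun rho) x t.
Proof.
have c0 : \prod_(i < n) (1 - t i * y) != 0.
  by apply/prodf_neq0 => i _; apply: t_reg.
(* The factor introduced by the row operations is also the product of the 1 - t_s x_n in the bottom
   entry of the last column, so it cancels. *)
apply: (mulfI c0); rewrite -det_red (expand_det_col _ ord_max) (bigD1 ord_max) //=.
rewrite big1 ?addr0; last first.
  move=> i ne; have lt : (i < n)%N.
    by rewrite ltn_neqAle -ltnS ltn_ord andbT -[n]/(nat_of_ord (ord_max : 'I_n.+1)) val_eqE.
  by rewrite mxE lt red_y ?mul0r.
rewrite mxE ltnn /cofactor /= addnn -muln2 exprM -exprM mulnC exprM sqrrN !expr1n mul1r.
rewrite /phi subnn addn0 (minn_idPl nr) -/y.
rewrite (_ : row' ord_max (col' ord_max red_matrix) = \matrix_(i, j)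
  ((x j - y) * \sum_(a < M.+1) weight i a *
     (x j ^+ (a + (n - i.+1)) * \prod_(s < minn i r) (1 - t s * x j)))); last first.
  by apply/matrixP => i j; rewrite !mxE !lift_max ltn_ord redE.
rewrite det_scale_cols det_sum_rows.
rewrite [_ * \prod_(s < n) _]mulrC -!mulrA; congr (_ * _).
rewrite mulrCA; congr (_ * (_ * _)).
rewrite [RHS]big_mkcond /=; apply: eq_bigr => rho _.
rewrite (det_scale_rows (fun i => weight i (rho i)) (fun i j =>
  (x j ^+ (rho i + (n - i.+1)) * \prod_(s < minn i r) (1 - t s * x j)))).
case: ifP => [/forallP inter | /negbT/forallPn[i Hi]]; last first.
  by rewrite (bigD1 i) //= /weight (negPf Hi) !mul0r.
congr (_ * _); first by apply: eq_bigr => i _; rewrite /weight inter.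
by congr (\det _); apply/matrixP => i j; rewrite !mxE shape_funE.
Qed.

End AlternantBranching.

(** Columns increase strictly, so a column of more than n boxes cannot be filled with n letters. In
    the branching rule, a nonempty row i+1 of mu forces a nonempty row i of rho while one letter is
    lost. *)
Lemma groth_on_eq0 (R : comNzRingType) N M n mu (x t : nat -> R) i :
  dec_on N mu -> (forall i, (i < N)%N -> (mu i <= M)%N) ->
  (forall i, (N <= i)%N -> mu i = 0%N) -> (n <= i)%N -> (0 < mu i)%N ->
  groth_on N M n mu x t = 0.
Proof.
move=> mudec muM mu0; elim: n mu i mudec muM mu0 => [|n IHn] mu i mudec muM mu0 ni pos.
  have iN : (i < N)%N by rewrite ltnNge; apply/negP => /mu0 E; rewrite E in pos.
  have M0 : (0 < M)%N by apply: leq_trans pos (muM _ iN).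
  rewrite /groth_on big_pred0 // => T; apply/svt_onP => -[S0 _ _].
  by move: pos; rewrite -(S0 (Ordinal iN, Ordinal M0)) => /set0Pn[[]].
case: i ni pos => // i ni pos.
have iN : (i.+1 < N)%N by rewrite ltnNge; apply/negP => /mu0 E; rewrite E in pos.
rewrite groth_on_branch // big1 // => rho /forallP inter.
rewrite (IHn _ i) ?mulr0 //.
- apply/dec_onP => j jN.
  rewrite (shape_funE rho (Ordinal jN)) (shape_funE rho (Ordinal (ltnW jN))).
  have /andP[_ le1] := inter (Ordinal jN); have /andP[le2 _] := inter (Ordinal (ltnW jN)).
  exact: leq_trans le1 le2.
- by move=> j _; apply: shape_fun_le.
- by move=> j Nj; rewrite /shape_fun insubF // ltnNge Nj.
- rewrite (shape_funE rho (Ordinal (ltnW iN))); apply: leq_trans pos _.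
  by case/andP: (inter (Ordinal (ltnW iN))).
Qed.

Lemma groth_on_shape0 (R : comNzRingType) N M n mu (x t : nat -> R) :
  (forall i, mu i = 0%N) -> groth_on N M n mu x t = 1.
Proof.
move=> mu0; rewrite /groth_on (big_pred1 [ffun=> set0]).
  by rewrite big1 // => b _; rewrite ffunE /box_weight cards0 big_set0 expr0 mulr1.
move=> T; apply/svt_onP/eqP => [[S0 _ _] | ->].
  by apply/ffunP => b; rewrite ffunE; apply/eqP; have := S0 b; rewrite mu0 ltn0 => /negbFE.
by split=> [b | b c _ r s | b c _ r s]; rewrite !ffunE ?mu0 ?eqxx ?inE.
Qed.

(** Both sides obey the same recursion in n. The tableau side sums over shapes with N rows; those
    with more than n nonzero rows contribute 0, and the others correspond to the shapes of the
    alternant side by padding with zeros. *)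
Lemma groth_alternant (F : fieldType) N M n mu (x t : nat -> F) :
  (n <= N)%N -> dec_on N mu -> (forall i, (i < N)%N -> (mu i <= M)%N) ->
  (forall i, (n <= i)%N -> mu i = 0%N) ->
  (forall i j, (i < j < n)%N -> 1 - t i * x j != 0) ->
  vdm n x * groth_on N M n mu x t = refined_alternant n N mu x t.
Proof.
elim: n mu => [|n IHn] mu nN mudec muM mu0 t_reg.
  rewrite groth_on_shape0; last by move=> i; apply: mu0.
  by rewrite /vdm big_ord0 mulr1 /refined_alternant det_mx00.
have mudec' : dec_on n.+1 mu.
  by apply/dec_onP => i lt; apply: dec_onS mudec (leq_trans lt nN).
rewrite (@alternant_branch _ n M N) // 1?ltnW //; last 2 first.
- by move=> i lt; apply: muM; apply: leq_trans lt (ltnW nN).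
- by move=> i lt; apply: t_reg; rewrite lt ltnSn.
rewrite groth_on_branch //; last by move=> i le; apply: mu0; apply: leq_trans nN le.
rewrite vdmS -mulrA mulrCA -[RHS]mulrA; congr (_ * _).
pose extend (rho : {ffun 'I_n -> 'I_M.+1}) : {ffun 'I_N -> 'I_M.+1} :=
  [ffun i : 'I_N => inord (shape_fun rho i)].
have extE rho i : (i < N)%N -> shape_fun (extend rho) i = shape_fun rho i.
  move=> lt; rewrite (shape_funE (extend rho) (Ordinal lt)) ffunE /= inordK //.
  by rewrite ltnS shape_fun_le.
rewrite (bigID (fun rho : {ffun 'I_N -> 'I_M.+1} =>
  [forall i : 'I_N, (n <= i)%N ==> (rho i == 0 :> nat)])) /=.
rewrite [X in _ + X]big1 ?addr0; last first.
  move=> rho /andP[/forallP inter /forallPn[i]]; rewrite negb_imply -lt0n => /andP[ni pos].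
  rewrite (@groth_on_eq0 _ _ _ _ _ _ _ i) ?mulr0 ?shape_funE //.
  - apply/dec_onP => j jN.
    rewrite (shape_funE rho (Ordinal jN)) (shape_funE rho (Ordinal (ltnW jN))).
    have /andP[_ le1] := inter (Ordinal jN); have /andP[le2 _] := inter (Ordinal (ltnW jN)).
    exact: leq_trans le1 le2.
  - by move=> j _; apply: shape_fun_le.
  - by move=> j Nj; rewrite /shape_fun insubF // ltnNge Nj.
rewrite (reindex_onto extend
  (fun rho => [ffun i : 'I_n => rho (widen_ord (ltnW nN) i)])) /=; last first.
  move=> rho /andP[_ /forallP rho0]; apply/ffunP => i; apply/val_inj.
  rewrite -[LHS]/(nat_of_ord _) -shape_funE extE //.
  case: (ltnP i n) => lt.
    by rewrite (shape_funE _ (Ordinal lt)) ffunE; congr (nat_of_ord (rho _)); apply/val_inj.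
  rewrite /shape_fun insubF ?ltnNge ?lt //=.
  by have /implyP/(_ lt)/eqP := rho0 i.
rewrite !big_distrr /=; apply: eq_big => rho.
  have extE' (i : 'I_N) : extend rho i = shape_fun rho i :> nat.
    by rewrite -shape_funE extE.
  have -> : [ffun i : 'I_n => extend rho (widen_ord (ltnW nN) i)] == rho.
    by apply/eqP/ffunP => i; rewrite ffunE; apply/val_inj; rewrite /= extE' shape_funE.
  have -> : [forall i : 'I_N, (n <= i)%N ==> (extend rho i == 0 :> nat)].
    apply/forallP => i; apply/implyP => ni; rewrite extE' /shape_fun insubF //.
    by rewrite ltnNge ni.
  rewrite !andbT; apply/forallP/forallP => inter i.
    by have := inter (widen_ord (ltnW nN) i); rewrite extE' shape_funE.
  rewrite extE'; case: (ltnP i n) => lt.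
    by rewrite (shape_funE _ (Ordinal lt)); apply: (inter (Ordinal lt)).
  by rewrite /shape_fun insubF ?ltnNge ?lt //= mu0.
move=> /andP[/andP[/forallP inter _] _].
have interS (i : 'I_N) : (mu i.+1 <= shape_fun rho i <= mu i)%N.
  by have := inter i; rewrite -shape_funE extE.
rewrite mulrCA IHn; last 5 first.
- exact: ltnW.
- apply/dec_onP => j jN; rewrite (extE _ _ jN) (extE _ _ (ltnW jN)).
  have /andP[_ le1] := interS (Ordinal jN); have /andP[le2 _] := interS (Ordinal (ltnW jN)).
  exact: leq_trans le1 le2.
- by move=> j _; apply: shape_fun_le.
- move=> j nj; case: (ltnP j N) => jN; last by rewrite /shape_fun insubF // ltnNge jN.
  by rewrite extE // /shape_fun insubF // ltnNge nj.
- by move=> i j /andP[ij jn]; apply: t_reg; rewrite ij ltnW.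
rewrite (@eq_alternant _ _ _ _ (shape_fun rho)); last first.
  by move=> i lt; rewrite extE // (leq_trans lt) // ltnW.
rewrite mulrA; congr (_ * _).
pose g (i : nat) := x n ^+ (mu i - shape_fun rho i) *
  (if (mu i.+1 < shape_fun rho i)%N then 1 - t i * x n else 1).
rewrite (eq_bigr (fun i : 'I_N => g i)); last first.
  by move=> i _; rewrite -shape_funE extE.
(* Rows beyond n are empty and give 1. Row n, where rho is 0, gives the factor x_n^(mu_n) standing
   outside the sum in [alternant_branch]. *)
rewrite (bigID (fun i : 'I_N => i < n.+1)%N) /= [X in _ * X]big1 ?mulr1; last first.
  move=> i; rewrite -ltnNge => lt.
  rewrite /g mu0 // /shape_fun insubF ?ltnn ?subnn ?expr0 ?mulr1 //.
  by rewrite ltnNge ltnW.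
rewrite -(big_ord_widen _ g nN) big_ord_recr /= mulrC /g.
rewrite [shape_fun rho n]/shape_fun insubF ?ltnn //= subn0 mulr1; congr (_ * _).
by apply: eq_bigr => i _; rewrite shape_funE.
Qed.

(** * Laplace expansion *)

Lemma prod_set_nth (R : comNzRingType) (I : finType) (z : I -> R) (S : {set I}) a
    (f : R -> R) :
  #|S| = a -> \prod_(i in S) f (z i) = \prod_(j < a) f (nth 0 [seq z i | i in S] j).
Proof.
move=> cS; rewrite -(big_mkord xpredT (fun j => f (nth 0 [seq z i | i in S] j))).
have -> : a = size [seq z i | i in S] by rewrite size_map -cardE.
by rewrite -(big_nth 0 xpredT f) big_map big_enum.
Qed.

Section Laplace.
Variables (F : fieldType) (n : nat).
Implicit Types (z : 'I_n -> F).

Definition vdm_ord z : F := \prod_(i < n) \prod_(j < n | (i < j)%N) (z i - z j).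

(** The negated variables reconcile the differences z_i - z_j with the opposite orientation in
    [det_Vandermonde]. As a determinant, the product visibly changes by a sign when the variables
    are permuted. *)
Lemma vdm_ordE z : vdm_ord z = \det (\matrix_(i < n, j < n) (- z j) ^+ i).
Proof.
transitivity (\det (Vandermonde n (\row_j (- z j)))).
  rewrite det_Vandermonde; apply: eq_bigr => i _; apply: eq_bigr => j _.
  by rewrite !mxE opprK addrC.
by congr (\det _); apply/matrixP => i j; rewrite !mxE.
Qed.

Lemma det_cols_perm (E : 'I_n -> 'I_n -> F) (s : 'S_n) :
  \det (\matrix_(i, j) E i (s j)) = (-1) ^+ s * \det (\matrix_(i, j) E i j).
Proof.
rewrite (_ : \matrix_(i, j) E i (s j) = col_perm s (\matrix_(i, j) E i j)).
  by rewrite col_permE det_mulmx det_perm odd_permV mulrC.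
by apply/matrixP => i j; rewrite !mxE.
Qed.

Lemma det_ratio_perm (E : 'I_n -> 'I_n -> F) z (s : 'S_n) :
  \det (\matrix_(i, j) E i j) / vdm_ord z =
  \det (\matrix_(i, j) E i (s j)) / vdm_ord (z \o s).
Proof.
rewrite !vdm_ordE det_cols_perm (det_cols_perm (fun i j => (- z j) ^+ i)).
by rewrite -mulf_div divff ?mul1r // signr_eq0.
Qed.

(** Every column is the sum of its part in the rows of P and its part in the other rows; S collects
    the columns for which the first part is chosen. *)
Lemma det_sum_cols (P : pred 'I_n) (E : 'I_n -> 'I_n -> F) :
  \det (\matrix_(i, j) E i j) =
  \sum_(S : {set 'I_n}) \det (\matrix_(i, j) (if (j \in S) == P i then E i j else 0)).
Proof.
rewrite -det_tr (_ : _^T = \matrix_(j, i)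
   \sum_(c : bool) (if c == P i then E i j else 0)); last first.
  apply/matrixP => i j; rewrite !mxE big_bool /=.
  by case: (P j); rewrite ?add0r ?addr0.
rewrite det_sum_rows (reindex_onto (fun S : {set 'I_n} => [ffun j => j \in S])
  (fun c : {ffun 'I_n -> bool} => [set j | c j])) /=; last first.
  by move=> c _; apply/ffunP => j; rewrite ffunE inE.
apply: eq_big => [S | S _].
  by apply/eqP/setP => j; rewrite inE ffunE.
by rewrite -[RHS]det_tr; congr (\det _); apply/matrixP => i j; rewrite !mxE ffunE.
Qed.

(** A nonzero term of the Leibniz formula would come from a permutation carrying P onto S. *)
Lemma det_split_eq0 (P : pred 'I_n) (E : 'I_n -> 'I_n -> F) (S : {set 'I_n}) :
  #|S| != #|P| ->
  \det (\matrix_(i, j) (if (j \in S) == P i then E i j else 0)) = 0.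
Proof.
move=> ne; rewrite /determinant big1 // => s _.
suff [i Hi] : exists i, (s i \in S) != P i.
  by rewrite (bigD1 i) //= mxE (negPf Hi) mul0r mulr0.
apply/existsP; apply: contraR ne => /existsPn H; rewrite -(card_imset P (@perm_inj _ s)).
apply/eqP/eq_card => j; rewrite -(permKV s j) mem_imset; last exact: perm_inj.
by have /negPn/eqP := H (s^-1 j)%g.
Qed.

End Laplace.

Lemma vdm_ord_split (F : fieldType) a k (z : 'I_(a + k) -> F) :
  vdm_ord z = vdm_ord (z \o lshift k) * vdm_ord (z \o @rshift a k)
    * \prod_(i < a) \prod_(j < k) (z (lshift k i) - z (rshift a j)).
Proof.
rewrite /vdm_ord big_split_ord /= mulrAC -big_split /=; congr (_ * _).
  apply: eq_bigr => i _; rewrite big_split_ord /=; congr (_ * _).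
  by apply: eq_bigl => j; rewrite ltn_addr.
apply: eq_bigr => i _; rewrite big_split_ord /= big_pred0 ?mul1r; last first.
  by move=> j; rewrite ltnNge ltnW // ltn_addr.
by apply: eq_bigl => j; rewrite ltn_add2l.
Qed.

Lemma laplace_ratio (F : fieldType) a k (z : 'I_(a + k) -> F) (e : nat -> F -> F) :
  \det (\matrix_(i < a + k, j < a + k) e i (z j)) / vdm_ord z =
  \sum_(S : {set 'I_(a + k)} | #|S| == k)
    (\det (\matrix_(i < a, j < a) e i (nth 0 [seq z l | l in ~: S] j))
       / vdm a (nth 0 [seq z l | l in ~: S]))
    * (\det (\matrix_(i < k, j < k) e (a + i)%N (nth 0 [seq z l | l in S] j))
         / vdm k (nth 0 [seq z l | l in S]))
    / \prod_(i in ~: S) \prod_(j in S) (z i - z j).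
Proof.
pose P (i : 'I_(a + k)) := (a <= i)%N.
have cP : #|P| = k.
  rewrite -sum1_card big_split_ord /= big_pred0 => [|i]; last first.
    by rewrite unfold_in /P /= leqNgt ltn_ord.
  rewrite add0n (eq_bigl xpredT) => [|i]; last by rewrite unfold_in /P /= leq_addr.
  by rewrite sum1_card card_ord.
rewrite (det_sum_cols P (fun i j => e i (z j))) big_distrl /=.
rewrite (bigID (fun S : {set 'I_(a + k)} => #|S| == k)) /=.
rewrite [X in _ + X]big1 ?addr0; last by move=> S ne; rewrite det_split_eq0 ?mul0r // cP.
apply: eq_bigr => S /eqP cS.
have cSC : #|~: S| = a by have := cardsC S; rewrite cS card_ord => /eqP; lia.
have sz : size (enum (~: S) ++ enum S) == (a + k)%N by rewrite size_cat -!cardE cS cSC.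
(* Listing the complement of S before S makes the matrix block diagonal and splits the Vandermonde
   product into the two smaller ones and the mixed differences. *)
pose w : (a + k).-tuple 'I_(a + k) := Tuple sz.
have w_uniq : uniq w.
  rewrite /= cat_uniq !enum_uniq /= andbT; apply/hasPn => j.
  by rewrite !mem_enum inE => ->.
pose s := perm (tuple_uniqP _ w_uniq).
have sE i : s i = nth i (enum (~: S) ++ enum S) i by rewrite permE (tnth_nth i).
have sl i : (s (lshift k i) \in S) = false.
  rewrite sE nth_cat -cardE cSC /= ltn_ord; apply/negbTE; rewrite -in_setC.
  by rewrite -mem_enum mem_nth // -cardE cSC.
have sr i : s (rshift a i) \in S.
  rewrite sE nth_cat -cardE cSC /= ltnNge leq_addr /= addKn.
  by rewrite -mem_enum mem_nth // -cardE cS.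
have zl i : z (s (lshift k i)) = nth 0 [seq z l | l in ~: S] i.
  rewrite sE nth_cat -cardE cSC /= ltn_ord (nth_map (lshift k i)) //.
  by rewrite -cardE cSC.
have zr i : z (s (rshift a i)) = nth 0 [seq z l | l in S] i.
  rewrite sE nth_cat -cardE cSC /= ltnNge leq_addr /= addKn (nth_map (rshift a i)) //.
  by rewrite -cardE cS.
rewrite (det_ratio_perm _ _ s) /=.
rewrite (_ : \matrix_(i, j) _ = block_mx
   (\matrix_(i < a, j < a) e i (nth 0 [seq z l | l in ~: S] j)) 0 0
   (\matrix_(i < k, j < k) e (a + i)%N (nth 0 [seq z l | l in S] j))); last first.
  apply/matrixP => i j; rewrite mxE /P.
  case: (split_ordP i) => i' ->; case: (split_ordP j) => j' ->.
  - by rewrite block_mxEul mxE sl /= leqNgt ltn_ord zl.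
  - by rewrite block_mxEur mxE sr /= leqNgt ltn_ord.
  - by rewrite block_mxEdl mxE sl /= leq_addr.
  - by rewrite block_mxEdr mxE sr /= leq_addr zr.
rewrite det_ublock vdm_ord_split.
have -> : vdm_ord ((z \o s) \o lshift k) = vdm a (nth 0 [seq z l | l in ~: S]).
  by apply: eq_bigr => i _; apply: eq_bigr => j _; rewrite /= !zl.
have -> : vdm_ord ((z \o s) \o @rshift a k) = vdm k (nth 0 [seq z l | l in S]).
  by apply: eq_bigr => i _; apply: eq_bigr => j _; rewrite /= !zr.
have -> : \prod_(i in ~: S) \prod_(j in S) (z i - z j) =
    \prod_(i < a) \prod_(j < k) ((z \o s) (lshift k i) - (z \o s) (rshift a j)).
  rewrite (@prod_set_nth _ _ z (~: S) a (fun u => \prod_(j in S) (u - z j))) //.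
  apply: eq_bigr => i _; rewrite (@prod_set_nth _ _ z S k (fun v => _ - v)) //.
  by apply: eq_bigr => j _; rewrite /= zl zr.
by rewrite !invfM !mulrA; congr (_ * _ / _); rewrite -!mulrA; congr (_ * _); rewrite mulrC.
Qed.

(** * Expansions in Schur polynomials *)

Lemma alternant0E (R : comNzRingType) n mu (x t : nat -> R) :
  refined_alternant n 0 mu x t = \det (\matrix_(i < n, j < n) x j ^+ (mu i + (n - i.+1))).
Proof.
by congr (\det _); apply/matrixP => i j; rewrite !mxE minn0 big_ord0 mulr1.
Qed.

Lemma alternant_t0 (R : comNzRingType) n r mu (x t : nat -> R) :
  (forall i, t i = 0) ->
  refined_alternant n r mu x t = \det (\matrix_(i < n, j < n) x j ^+ (mu i + (n - i.+1))).
Proof.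
move=> t0; congr (\det _); apply/matrixP => i j; rewrite !mxE big1 ?mulr1 // => s _.
by rewrite t0 mul0r subr0.
Qed.

(** The empty shape has a single tableau, of weight 1, so [groth_alternant] with t = 0 evaluates
    this determinant. *)
Lemma vdm_alternant (F : fieldType) n (x : nat -> F) :
  \det (\matrix_(i < n, j < n) x j ^+ (n - i.+1)) = vdm n x.
Proof.
have := @groth_alternant F n 0 n (fun=> 0%N) x (fun=> 0).
rewrite groth_on_shape0 // mulr1 alternant_t0 // => -> //.
  by apply/dec_onP.
by move=> i j _; rewrite mul0r subr0 oner_neq0.
Qed.

Lemma vdm_neq0 (F : fieldType) (s : seq F) : uniq s -> vdm (size s) (nth 0 s) != 0.
Proof.
move=> us; apply/prodf_neq0 => i _; apply/prodf_neq0 => j ij.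
by rewrite subr_eq0 nth_uniq // ltn_eqF.
Qed.

Lemma max_sorted_geq (s : seq nat) M :
  sorted geq s -> (nth 0%N s 0 <= M)%N -> (\max_(r <- s) r <= M)%N.
Proof.
case: s => [|r0 s] /= srt r0M; first by rewrite big_nil.
apply/bigmax_leqP_seq => r; rewrite inE => /orP[/eqP -> // | rs] _.
have geq_tr : transitive geq by move=> i j l ji il; apply: leq_trans il ji.
by have /allP/(_ r rs) := order_path_min geq_tr srt; move/leq_trans; apply.
Qed.

Lemma dec_on_nth (s : seq nat) : sorted geq s = dec_on (size s) (nth 0%N s).
Proof. by apply/(sortedP 0%N)/dec_onP. Qed.

Lemma nth_max_le (s : seq nat) M i : (\max_(r <- s) r <= M)%N -> (nth 0%N s i <= M)%N.
Proof.
move=> sM; case: (ltnP i (size s)) => lt; last by rewrite nth_default.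
by apply: leq_trans sM; apply: (@leq_bigmax_seq _ _ xpredT id) => //; apply: mem_nth.
Qed.

Lemma schur_bialternant (F : fieldType) (nu : seq nat) (y : seq F) :
  sorted geq nu -> size nu = size y -> uniq y ->
  schur nu y = \det (\matrix_(i < size y, j < size y)
    nth 0 y j ^+ (nth 0%N nu i + (size y - i.+1))) / vdm (size y) (nth 0 y).
Proof.
move=> nu_sorted szy uy; pose M := \max_(r <- nu) r.
have nuM : (\max_(r <- nu) r <= M)%N by [].
apply: (canRL (mulfK (vdm_neq0 uy))); rewrite mulrC schur_groth.
rewrite (groth_ambient _ szy erefl nuM) groth_alternant //.
- by rewrite alternant_t0 // => i; rewrite nth_nil.
- by rewrite -szy -dec_on_nth.
- by move=> i _; apply: nth_max_le.
- by move=> i le; rewrite nth_default // szy.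
- by move=> i j _; rewrite nth_nil mul0r subr0 oner_neq0.
Qed.

(* The rows of the rectangle contribute [x^m] times a Vandermonde determinant
   to each term of the Laplace expansion. *)
Lemma laplace_schur (F : fieldType) a k m (x : 'I_(a + k) -> F) (nu : seq nat) :
  injective x -> (k <= m)%N -> sorted geq nu -> size nu = k ->
  \det (\matrix_(i < a + k, j < a + k)
     x j ^+ (nth 0%N (nseq a (m - k)%N ++ nu) i + (a + k - i.+1))) / vdm_ord x =
  \sum_(S : {set 'I_(a + k)} | #|S| == k)
    (\prod_(i in ~: S) x i ^+ m)
    * (\prod_(i in ~: S) \prod_(j in S) (1 / (x i - x j)))
    * schur nu [seq x i | i in S].
Proof.
move=> injx km nu_sorted sz_nu.
rewrite (laplace_ratio x (fun i u =>
  u ^+ (nth 0%N (nseq a (m - k)%N ++ nu) i + (a + k - i.+1)))).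
apply: eq_bigr => S /eqP cS.
have cSC : #|~: S| = a by have := cardsC S; rewrite cS card_ord => /eqP; lia.
have x_uniq (A : {set 'I_(a + k)}) : uniq [seq x i | i in A].
  by rewrite map_inj_uniq // enum_uniq.
have szS : size [seq x i | i in S] = k by rewrite size_map -cardE.
rewrite schur_bialternant ?szS //.
rewrite (_ : \matrix_(i, j) _ = \matrix_(i < a, j < a)
   (nth 0 [seq x i | i in ~: S] j ^+ m * nth 0 [seq x i | i in ~: S] j ^+ (a - i.+1)));
  last first.
  apply/matrixP => i j; rewrite !mxE nth_cat size_nseq ltn_ord nth_nseq ltn_ord -exprD.
  (* Since k <= m, the exponent (m - k) + (a + k - i - 1) equals m + (a - i - 1). *)
  by congr (_ ^+ _); have := ltn_ord i; lia.
rewrite (det_scale_cols (fun j => nth 0 [seq x i | i in ~: S] j ^+ m)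
  (fun i j => nth 0 [seq x i | i in ~: S] j ^+ (a - i.+1))).
rewrite vdm_alternant mulfK; last first.
  by have := vdm_neq0 (x_uniq (~: S)); rewrite size_map -cardE cSC.
rewrite -(@prod_set_nth _ _ x (~: S) a (fun u => u ^+ m)) // -mulrA -[RHS]mulrA.
congr (_ * _); rewrite [LHS]mulrC; congr (_ * (_ / _)).
  rewrite -prodfV; apply: eq_bigr => i _; rewrite -prodfV; apply: eq_bigr => j _.
  by rewrite div1r.
congr (\det _); apply/matrixP => i j.
rewrite !mxE nth_cat size_nseq ltnNge leq_addr addKn.
by rewrite -addnS subnDl.
Qed.

Section Genericity.
Variable n : nat.

Lemma xvar_inj : injective (@xvar n).
Proof.
move=> i j /eqP; rewrite /xvar tofrac_eq => /eqP /(congr1 (meval (fun l =>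
  (l == lshift n i)%:R))).
rewrite !mevalXU eqxx; case: eqVneq => [/lshift_inj -> // | _ /eqP].
by rewrite oner_eq0.
Qed.

Lemma one_sub_tvar_xvar (i j : 'I_n) : 1 - tvar i * xvar j != 0.
Proof.
rewrite /tvar /xvar -tofracM -tofrac1 -tofracB tofrac_eq0; apply/eqP.
move/(congr1 (meval (fun=> 0))).
by rewrite mevalB mevalM !mevalXU meval1 meval0 mul0r subr0 => /eqP; rewrite oner_eq0.
Qed.

Lemma nth_xvars (i : 'I_n) : nth 0 (xvars n) i = xvar i.
Proof. by rewrite /xvars /image_mem (nth_map i) ?size_enum_ord // nth_ord_enum. Qed.

Lemma nth_tvars (i : 'I_n) : nth 0 (tvars n) i = tvar i.
Proof. by rewrite /tvars /image_mem (nth_map i) ?size_enum_ord // nth_ord_enum. Qed.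

End Genericity.

(* Lenart's expansion of Grothendieck into Schur polynomials, with the Schur
   polynomials as ratios of alternants. *)
Lemma groth_expansion (F : fieldType) (n M : nat) (mu : seq nat) (x t : seq F) :
  size mu = n -> size x = n -> uniq x -> sorted geq mu -> (nth 0%N mu 0 <= M)%N ->
  (forall i j, (i < n)%N -> (j < n)%N -> 1 - nth 0 t i * nth 0 x j != 0) ->
  groth mu x t =
  \sum_(kappa : {ffun 'I_n -> 'I_M.+1} | dec_on n (shape_fun kappa))
    E_on n M n (nth 0%N mu) (shape_fun kappa) (fun i => - nth 0 t i)
    * (refined_alternant n 0 (shape_fun kappa) (nth 0 x) (nth 0 t) / vdm n (nth 0 x)).
Proof.
move=> sz_mu sz_x x_uniq mu_sorted muM t_reg.
have mu_max := max_sorted_geq mu_sorted muM.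
have mu_dec : dec_on n (nth 0%N mu) by rewrite -sz_mu -dec_on_nth.
rewrite (groth_ambient t sz_mu sz_x mu_max).
have v0 : vdm n (nth 0 x) != 0 by rewrite -sz_x vdm_neq0.
apply: (mulfI v0); rewrite groth_alternant //.
- rewrite (@alternant_E _ _ M) //; last by move=> i _; apply: nth_max_le.
  rewrite big_distrr /=; apply: eq_bigr => kappa _.
  by rewrite [RHS]mulrCA [vdm _ _ * _]mulrC divfK.
- by move=> i _; apply: nth_max_le.
- by move=> i le; rewrite nth_default // sz_mu.
- by move=> i j /andP[ij jn]; apply: t_reg => //; apply: ltn_trans ij jn.
Qed.

(** No part of kappa exceeds M, so a row of mu of length M fits into kappa only if that row of kappa
    is full as well. This leaves only the shapes that begin with the whole rectangle. *)
Lemma E_on_full_rows (R : comNzRingType) n M r (mu : nat -> nat)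
    (kappa : {ffun 'I_n -> 'I_M.+1}) (t : nat -> R) (i : 'I_n) :
  mu i = M -> kappa i != M :> nat -> E_on n M r mu (shape_fun kappa) t = 0.
Proof.
move=> muM ne; rewrite /E_on ifF //; apply/forallP => /(_ i).
by rewrite muM shape_funE leqNgt ltn_neqAle ne -ltnS ltn_ord.
Qed.

Lemma eq_E_on (R : comNzRingType) N M r (eta kappa kappa' : nat -> nat) (t t' : nat -> R) :
  (forall i, kappa i = kappa' i) -> (forall i, t i = t' i) ->
  E_on N M r eta kappa t = E_on N M r eta kappa' t'.
Proof.
move=> kE tE; rewrite /E_on; under eq_forallb => i do rewrite kE.
case: ifP => // _; apply: eq_big => [g | g _].
  by congr (_ && _); apply: eq_forallb => b; rewrite kE.
by apply: eq_bigr => b _; rewrite tE.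
Qed.

Theorem proposition5p15 (n m k : nat) (lam : k.-tuple nat)
  (hkn : (k <= n)%N) (hkm : (k <= m)%N)
  (hlam : sorted geq lam) (hlam1 : (nth 0%N lam 0 <= m - k)%N) :
  groth (prepend n m k lam) (xvars n) (tvars n) =
  \sum_(S : {set 'I_n} | #|S| == k)
    (\prod_(i in ~: S) xvar i ^+ m)
    * (\prod_(i in ~: S) \prod_(j in S) (1 / (xvar i - xvar j)))
    * W n m k lam (xvars_in S) (tvars n).
Proof.
(* Writing n as a + k lets [lshift] and [rshift] separate the rows of the rectangle from those of
   lambda. *)
have [a nE] : exists a, n = (a + k)%N by exists (n - k)%N; rewrite subnK.
rewrite {hkn}nE {n}.
have prependE s : prepend (a + k) m k s = nseq a (m - k)%N ++ s.
  by rewrite /prepend addnK.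
set M := (m - k)%N in hlam1 prependE *.
have sz_lam : size lam = k by apply: size_tuple.
have sz_prep (s : seq nat) : size s = k -> size (prepend (a + k) m k s) = (a + k)%N.
  by move=> ss; rewrite prependE size_cat size_nseq ss.
have prep0 (s : seq nat) : (nth 0%N s 0 <= M)%N ->
    (nth 0%N (prepend (a + k) m k s) 0 <= M)%N.
  by rewrite prependE; case: (a) => //= b; rewrite leqnn.
have prep_sorted (s : seq nat) : sorted geq s -> (nth 0%N s 0 <= M)%N ->
    sorted geq (prepend (a + k) m k s).
  move=> ss s0; have smax := max_sorted_geq ss s0.
  apply/(sortedP 0%N) => i; rewrite prependE size_cat size_nseq !nth_cat size_nseq !nth_nseq.
  case: (ltnP i.+1 a) => [lt _ | le lt]; first by rewrite (ltnW lt) /=.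
  case: (ltnP i a) => [_ | le']; first exact: nth_max_le.
  by rewrite subSn //; move/(sortedP 0%N): ss; apply; lia.
rewrite (@groth_expansion _ (a + k) M); first last.
- move=> i j il jl; rewrite -[i]/(nat_of_ord (Ordinal il)) -[j]/(nat_of_ord (Ordinal jl)).
  by rewrite nth_tvars nth_xvars one_sub_tvar_xvar.
- exact: prep0.
- exact: prep_sorted.
- by rewrite /xvars map_inj_uniq ?enum_uniq //; apply: xvar_inj.
- by rewrite size_map size_enum_ord.
- exact: sz_prep.
have nu_max (nu : k.-tuple 'I_M.+1) i : (nth 0%N (map val nu) i <= M)%N.
  case: (ltnP i (size nu)) => lt; last by rewrite nth_default // size_map.
  by rewrite (nth_map ord0) // -ltnS ltn_ord.
have sz_nu (nu : k.-tuple 'I_M.+1) : size (map val nu) = k by rewrite size_map size_tuple.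
(* [fill] matches the index set of W with the shapes whose first a rows have length M; reading off
   the last k rows is its inverse. *)
pose fill (nu : k.-tuple 'I_M.+1) : {ffun 'I_(a + k) -> 'I_M.+1} :=
  [ffun i : 'I_(a + k) => inord (nth 0%N (prepend (a + k) m k (map val nu)) i)].
have fillE nu i : shape_fun (fill nu) i = nth 0%N (prepend (a + k) m k (map val nu)) i.
  rewrite /shape_fun; case: insubP => [j _ <- /= | ].
    rewrite ffunE inordK // ltnS prependE nth_cat size_nseq nth_nseq.
    by case: ifP => [-> // | _]; apply: nu_max.
  by rewrite -leqNgt => le; rewrite nth_default ?sz_prep.
rewrite (bigID (fun kappa : {ffun 'I_(a + k) -> 'I_M.+1} =>
  [forall i : 'I_(a + k), (i < a)%N ==> (kappa i == M :> nat)])) /=.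
rewrite [X in _ + X]big1 ?addr0; last first.
  move=> kappa /andP[_ /forallPn[i]]; rewrite negb_imply => /andP[ia ne].
  by rewrite (@E_on_full_rows _ _ _ _ _ _ _ i) ?mul0r // prependE nth_cat size_nseq ia nth_nseq ia.
rewrite (reindex_onto fill (fun kappa => [tuple kappa (rshift a i) | i < k])) /=; last first.
  move=> kappa /andP[_ /forallP H]; apply/ffunP => i; apply/val_inj.
  rewrite -[LHS]/(nat_of_ord _) -shape_funE fillE prependE nth_cat size_nseq nth_nseq.
  case: (split_ordP i) => j ->.
    by have := H (lshift k j); rewrite /= ltn_ord => /eqP.
  rewrite /= addKn (nth_map ord0) ?size_map -?enumT ?size_enum_ord //.
  by rewrite (nth_map j) ?size_enum_ord // nth_ord_enum.
have in_range nu : [forall i : 'I_(a + k), (i < a)%N ==> (fill nu i == M :> nat)].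
  apply/forallP => l; apply/implyP => la.
  by rewrite -shape_funE fillE prependE nth_cat size_nseq la nth_nseq la.
have fillK nu : [tuple fill nu (rshift a i) | i < k] = nu.
  apply: eq_from_tnth => i; rewrite tnth_mktuple; apply/val_inj.
  rewrite -[LHS]/(nat_of_ord _) -shape_funE fillE prependE nth_cat size_nseq /=.
  by rewrite ltnNge leq_addr addKn (nth_map ord0) ?size_tuple // -tnth_nth.
have fill_sorted nu : dec_on (a + k) (shape_fun (fill nu)) = sorted geq (map val nu).
  apply/dec_onP/idP => [H | nu_sorted i ilt]; last first.
    rewrite !fillE; apply: (@dec_onS (a + k)) => //.
    by have := prep_sorted _ nu_sorted (nu_max nu 0%N); rewrite dec_on_nth sz_prep.
  apply/(sortedP 0%N) => i; rewrite sz_nu => ilt.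
  have := H (a + i)%N; rewrite -addnS ltn_add2l !fillE prependE !nth_cat size_nseq.
  have ge_a j : (a + j < a)%N = false by rewrite ltnNge leq_addr.
  by rewrite !ge_a !addKn => /(_ ilt).
(* The sum over nu is brought outside the sum over S, so that the two sides are compared for each nu
   separately. *)
under [RHS]eq_bigr => S _.
  rewrite /W big_distrr /=.
  over.
rewrite /= [RHS]exchange_big /=.
apply: eq_big => nu; first by rewrite in_range fillK eqxx !andbT fill_sorted.
case/andP => /andP[nu_sorted _] _; rewrite fill_sorted in nu_sorted.
have nu_sz := sz_nu nu.
transitivity (Ecoef (prepend (a + k) m k lam) (prepend (a + k) m k (map val nu))
   (map -%R (tvars (a + k))) * \sum_(S : {set 'I_(a + k)} | #|S| == k)
    (\prod_(i in ~: S) xvar i ^+ m)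
    * (\prod_(i in ~: S) \prod_(j in S) (1 / (xvar i - xvar j)))
    * schur (map val nu) (xvars_in S)); last first.
  by rewrite big_distrr /=; apply: eq_bigr => S _; rewrite mulrCA.
rewrite (@Ecoef_ambient _ (a + k) M) ?sz_prep //; last first.
  by apply: max_sorted_geq; [apply: prep_sorted | apply: prep0].
congr (_ * _).
  apply: eq_E_on => [i | i]; first exact: fillE.
  case: (ltnP i (size (tvars (a + k)))) => lt; first by rewrite (nth_map 0).
  by rewrite !nth_default ?oppr0 // size_map.
rewrite /xvars_in -(@laplace_schur _ a k m _ _ (@xvar_inj _) hkm nu_sorted nu_sz) alternant0E.
congr (\det _ / _).
  by apply/matrixP => i j; rewrite !mxE nth_xvars fillE prependE.
by apply: eq_bigr => i _; apply: eq_bigr => j _; rewrite !nth_xvars.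
Qed.
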